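(* The NGEV equilibrium assignment is equivalent to each of the following variational inequality problems. [VI-D] Find $\hat{\mathbf x}^*\in\hat X$ with $\mathbf x^*=\sum_{d\in\mathcal D}\mathbf x_d^*\in X\cap Y$ such that $$\sum_{d\in\mathcal D}[\mathbf C(\mathbf x^* )-\nabla H_d(\mathbf x_d^* )]\cdot(\mathbf x_d-\mathbf x_d^* )\ge0\quad\text{for all }\hat{\mathbf x}\in\hat X\text{ with }\mathbf x=\sum_{d\in\mathcal D}\mathbf x_d\in X\cap Y.$$ [VI-C] Find $\mathbf c^*\in\mathcal C$ such that $$\Big[\mathbf C^{-1}(\mathbf c^* )-\sum_{d\in\mathcal D}\nabla H_d^*(\mathbf c^* )\Big]\cdot(\mathbf c-\mathbf c^* )\ge0\quad\text{for all }\mathbf c\in\mathcal C.$$ That is, $\hat{\mathbf x}^*$ is the flow component of a solution of the NGEV equilibrium assignment if and only if it solves [VI-D], and $\mathbf c^*$ is the cost component of a solution if and only if it solves [VI-C].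
   Context: Network. $G=(\mathcal N,\mathcal L)$ is a finite directed time-space network; $\mathcal L=\mathcal L_T\cup\mathcal L_A\cup\mathcal L_B\cup\mathcal L_Q$ is partitioned into time-space (driving), access/egress/transfer, on-board and boarding-queue links. $\Psi$ is the set of run-station pairs $(r,s)$, and $\mathcal L_Q$ is the disjoint union of sets $\mathcal L_Q^{(r,s)}$, $(r,s)\in\Psi$, each consisting of links numbered $l=1,\dots,N$. For each $(r,s)$ there is a sequence of on-board nodes $1,\dots,N$; the $l$-th boarding-queue link (flow $z_l^{(r,s)}$) enters the $l$-th on-board node, the $l$-th on-board link (flow $x_l^{(r,s)}$) leaves it, and $x_0^{(r,s)}$ is the flow on the link of run $r$ entering the first on-board node; flow conservation gives $x_l^{(r,s)}=x_{l-1}^{(r,s)}+z_l^{(r,s)}=x_0^{(r,s)}+\sum_{k=1}^l z_k^{(r,s)}$. Costs. The vector link cost function $\mathbf C$ maps aggregated link flows $\mathbf x\in\mathbb R_+^{|\mathcal L|}$ to link costs as follows. The cost of each link $ij\in\mathcal L_T\cup\mathcal L_A\cup\mathcal L_B$ is a continuous, differentiable, strictly increasing function of its own flow $x_{ij}$. On-board links of run $r$ have capacity $\mu^{(r)}$, and the cost of the $l$-th boarding-queue link of $(r,s)$ is $f_l\big(x_0^{(r,s)}+\sum_{k=1}^l z_k^{(r,s)}\mid\mu^{(r)}\big)$, where $f_l(\cdot\mid\mu)$ is continuous, differentiable and strictly increasing with $\lim_{x\to\mu}f_l(x\mid\mu)=+\infty$ (value $+\infty$ for $x\ge\mu$). Costs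 are nonnegative. $Y$ (supply-feasible flows) is the set of $\mathbf x\in\mathbb R_+^{|\mathcal L|}$ with $\mathbf C(\mathbf x)$ finite; $\mathcal C=\{\mathbf C(\mathbf x):\mathbf x\in Y\}$; $\mathbf C:Y\to\mathcal C$ is one-to-one with inverse $\mathbf C^{-1}:\mathcal C\to Y$. Demand. $\mathcal D$ is the set of destinations; $\mathbf q_d=(q_i^d)_{i\in\mathcal N}$ is the given demand to $d$, with $q_i^d>0$ when $(i,d)$ is an origin-destination pair and $q_i^d=0$ otherwise. $\mathcal F(i)$ and $\mathcal B(i)$ are the sets of successor and predecessor nodes of $i$. $X_d$ is the set of $\mathbf x_d=(x^d_{ij})_{ij\in\mathcal L}\ge\mathbf 0$ with $\sum_{n\in\mathcal F(i)}x_{in}^d-\sum_{n\in\mathcal B(i)}x_{ni}^d=q_i^d$ for all $i\in\mathcal N\setminus\{d\}$. $\hat X=\prod_{d\in\mathcal D}X_d$, with elements $\hat{\mathbf x}=(\mathbf x_d)_{d\in\mathcal D}$; $X=\{\sum_d\mathbf x_d:\hat{\mathbf x}\in\hat X\}$. NGEV equilibrium assignment. Parameters: $\theta_i^d>0$ and $\alpha_{ji}^d\ge0$ with $\sum_{i\in\mathcal B(j)}\alpha_{ji}^d=1$. The problem is to find link costs $\mathbf c=(c_{ij})$, flows $\hat{\mathbf x}\in\hat X$ with $\mathbf x=\sum_d\mathbf x_d\in X\cap Y$, and expected minimum costs $(s_{id})_{i\in\mathcal N,d\in\mathcal D}$ (with $s_{dd}=0$) such that $\mathbf c=\mathbf C(\mathbf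 x)$ and, for all $d\in\mathcal D$, all $i\in\mathcal N\setminus\{d\}$ and all links $ij$, $$p^d_{ij|i}=\frac{\alpha^d_{ji}e^{-\theta^d_i(c_{ij}+s_{jd})}}{\sum_{n\in\mathcal F(i)}\alpha^d_{ni}e^{-\theta^d_i(c_{in}+s_{nd})}},\quad 1=\sum_{n\in\mathcal F(i)}\alpha^d_{ni}e^{-\theta^d_i(c_{in}+s_{nd}-s_{id})},\quad x^d_{ij}=p^d_{ij|i}\sum_{n\in\mathcal F(i)}x^d_{in}.$$ Entropy. With the convention $0\ln0=0$, $$H_d(\mathbf x_d)=-\sum_{i\in\mathcal N}\frac1{\theta_i^d}\sum_{j\in\mathcal F(i)}x_{ij}^d\Big[\ln\frac{x_{ij}^d}{\sum_{n\in\mathcal F(i)}x_{in}^d}-\ln\alpha_{ji}^d\Big],\qquad H_d^*(\mathbf c)=\min_{\mathbf x_d\in X_d}[\mathbf c\cdot\mathbf x_d-H_d(\mathbf x_d)]\quad(\mathbf c\in\mathcal C).$$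
   Formalization: Time-space network read as acyclic; s_id=+∞ where d is unreachable along links with α>0 (recursion required only elsewhere); α sums to 1 only at nodes with predecessors; ∇H_d at zero flow is the one-sided, possibly infinite, derivative, with +∞ prevailing in sums and H_d(x* ) finite. *)

(* Defs.v *)
From HB Require Import structures.
From mathcomp Require Import all_boot all_order all_algebra.
From mathcomp Require Import all_classical all_reals all_analysis.

Set Implicit Arguments.
Unset Strict Implicit.
Unset Printing Implicit Defensive.

Import Order.TTheory GRing.Theory Num.Theory.
Import numFieldNormedType.Exports.

Local Open Scope classical_set_scope.
Local Open Scope ring_scope.

Variant link_kind := Driving | Access | OnBoard | Queue.

(* Links are numbered, so that R^|L| is the normed space 'rV[R]_(nlinks G).
   The i-th successor of a node is reached by exactly one link, hence sums over
   F(i) (resp. B(i)) are sums over the links a with src a = i (resp. tgt a = i).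
   On-board nodes and queue links are indexed by 'I_nqueue, from 0, whereas
   obl rs k, for k = 0..nqueue, carries the flow written x_k: obl rs 0 is the
   link of the run entering the first on-board node, and obl rs (l + 1) is the
   on-board link leaving the on-board node of index l. *)
Record network := Network {
  node : finType;
  nlinks : nat;
  src : 'I_nlinks -> node;
  tgt : 'I_nlinks -> node;
  kind : 'I_nlinks -> link_kind;
  run : finType;
  station : finType;
  run_stations : {set run * station};
  nqueue : nat;
  qlink : {rs | rs \in run_stations} -> 'I_nqueue -> 'I_nlinks;
  onode : {rs | rs \in run_stations} -> 'I_nqueue -> node;
  obl : {rs | rs \in run_stations} -> 'I_nqueue.+1 -> 'I_nlinks;
  link_inj : forall a b, src a = src b -> tgt a = tgt b -> a = b;
  (* a time-space network has no directed cycle *)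
  acyclic : forall a,
    ~~ connect [rel i j | [exists b, (src b == i) && (tgt b == j)]]
         (tgt a) (src a);
  qlink_inj : forall rs l rs' l',
    qlink rs l = qlink rs' l' -> rs = rs' /\ l = l';
  queueP : forall a, kind a = Queue <-> exists rs l, a = qlink rs l;
  entry_kind : forall rs,
    kind (obl rs ord0) = Driving \/ kind (obl rs ord0) = OnBoard;
  obl_kind : forall rs (l : 'I_nqueue), kind (obl rs (lift ord0 l)) = OnBoard;
  onode_in : forall rs (l : 'I_nqueue) a, tgt a = onode rs l <->
    a = qlink rs l \/ a = obl rs (widen_ord (leqnSn nqueue) l);
  onode_out : forall rs (l : 'I_nqueue) a, src a = onode rs l <->
    a = obl rs (lift ord0 l)
}.

Definition link (G : network) := 'I_(nlinks G).
Definition rs_pair (G : network) := {rs | rs \in run_stations G}.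

(* queue_cost l mu is f_l(. | mu) on [0, mu[; it is taken to be +oo beyond
   mu in [link_cost] below.  own_cost a is only used when a is not a queue
   link. *)
Record cost_data (R : realType) (G : network) := CostData {
  own_cost : link G -> R -> R;
  queue_cost : 'I_(nqueue G) -> R -> R -> R;
  capacity : run G -> R;
  capacity_gt0 : forall r, 0 < capacity r;
  own_cost_cont : forall a, kind a <> Queue ->
    {within `[0, +oo[, continuous (own_cost a)};
  own_cost_diff : forall a, kind a <> Queue ->
    {in `]0, +oo[, forall x, derivable (own_cost a) x 1};
  own_cost_incr : forall a, kind a <> Queue ->
    {in `[0, +oo[ &, {homo own_cost a : x y / x < y}};
  own_cost_ge0 : forall a, kind a <> Queue ->
    {in `[0, +oo[, forall x, 0 <= own_cost a x};
  queue_cost_cont : forall l (mu : R), 0 < mu ->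
    {within `[0, mu[, continuous (queue_cost l mu)};
  queue_cost_diff : forall l (mu : R), 0 < mu ->
    {in `]0, mu[, forall x, derivable (queue_cost l mu) x 1};
  queue_cost_incr : forall l (mu : R), 0 < mu ->
    {in `[0, mu[ &, {homo queue_cost l mu : x y / x < y}};
  queue_cost_ge0 : forall l (mu : R), 0 < mu ->
    {in `[0, mu[, forall x, 0 <= queue_cost l mu x};
  queue_cost_lim : forall l (mu : R), 0 < mu ->
    queue_cost l mu x @[x --> mu^'-] --> +oo
}.

Record demand_data (R : realType) (G : network) := DemandData {
  dests : {set node G};
  od_pair : {set node G * node G};
  demand : node G -> node G -> R;
  demand_gt0 : forall d i, d \in dests -> (i, d) \in od_pair ->
    0 < demand d i;
  demand_eq0 : forall d i, d \in dests -> (i, d) \notin od_pair ->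
    demand d i = 0;
  (* needed for flow conservation at on-board nodes, see [obl_flow] *)
  onode_dest : forall rs l, @onode G rs l \notin dests;
  onode_od : forall rs l d, (@onode G rs l, d) \notin od_pair
}.

(* allocation d a is alpha^d_{ji} for the link a = ij *)
Record ngev_data (R : realType) (G : network) (M : demand_data R G) :=
  NgevData {
  scale : node G -> node G -> R;
  allocation : node G -> link G -> R;
  scale_gt0 : forall d i, d \in dests M -> 0 < scale d i;
  allocation_ge0 : forall d a, d \in dests M -> 0 <= allocation d a;
  allocation_sum1 : forall d j, d \in dests M -> (exists a, tgt a = j) ->
    \sum_(a | tgt a == j) allocation d a = 1
}.

Section Model.
Variables (R : realType) (G : network).
Local Notation flow := 'rV[R]_(nlinks G).

Definition dot (u v : flow) : R := \sum_a u 0 a * v 0 a.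

Definition outflow (x : flow) (i : node G) : R := \sum_(a | src a == i) x 0 a.
Definition inflow (x : flow) (i : node G) : R := \sum_(a | tgt a == i) x 0 a.

Section Supply.
Variable K : cost_data R G.

Definition queue_load (x : flow) (rs : rs_pair G) (l : 'I_(nqueue G)) : R :=
  x 0 (obl rs ord0) + \sum_(k < nqueue G | (k <= l)%N) x 0 (qlink rs k).

Definition link_cost (x : flow) (a : link G) : \bar R :=
  match [pick p : rs_pair G * 'I_(nqueue G) | qlink p.1 p.2 == a] with
  | Some p =>
      let mu := capacity K (val p.1).1 in
      let y := queue_load x p.1 p.2 in
      if y < mu then (queue_cost K p.2 mu y)%:E else +oo%E
  | None => (own_cost K a (x 0 a))%:E
  end.

Definition supply_feasible : set flow :=
  [set x : flow | (forall a, 0 <= x 0 a) /\ forall a, link_cost x a \is a fin_num].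

Definition cost (x : flow) : flow := \row_a fine (link_cost x a).

Definition cost_range : set flow := cost @` supply_feasible.

Definition cost_inv : flow -> flow := 'pinv_(fun=> 0) supply_feasible cost.

End Supply.

Section Demand.
Variable M : demand_data R G.

Definition Xd (d : node G) : set flow :=
  [set x : flow | (forall a, 0 <= x 0 a) /\
     forall i, i != d -> outflow x i - inflow x i = demand M d i].

(* A family of flows is indexed by all nodes; only its components at the
   destinations matter. *)
Definition Xhat : set (node G -> flow) :=
  [set xh | forall d, d \in dests M -> Xd d (xh d)].

Definition aggregate (xh : node G -> flow) : flow :=
  \sum_(d in dests M) xh d.

Definition Xagg : set flow := aggregate @` Xhat.

Lemma obl_flow (x : flow) (rs : rs_pair G) (l : 'I_(nqueue G)) : Xagg x ->
  x 0 (obl rs (lift ord0 l)) =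
  x 0 (obl rs (widen_ord (leqnSn _) l)) + x 0 (qlink rs l).
Proof.
have qNobl : qlink rs l != obl rs (widen_ord (leqnSn _) l).
  apply/eqP => e.
  have kq : kind (obl rs (widen_ord (leqnSn _) l)) = Queue.
    by apply/queueP; exists rs, l.
  have [l0|l0] := posnP l.
    have e0 : widen_ord (leqnSn (nqueue G)) l = ord0 by exact/val_inj.
    by move: kq; rewrite e0; case: (entry_kind rs) => ->.
  have lt1 : (l.-1 < nqueue G)%N by exact: leq_ltn_trans (leq_pred _) (ltn_ord l).
  have e0 : widen_ord (leqnSn (nqueue G)) l = lift ord0 (Ordinal lt1).
    by apply/val_inj; rewrite /= /bump /= add1n prednK.
  by move: kq; rewrite e0 obl_kind.
case=> xh xhX <-; rewrite /aggregate !summxE -big_split /=.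
apply: eq_bigr => d dD; have [_ cons] := xhX d dD.
have nd : onode rs l != d by apply: contraNneq (onode_dest M rs l) => ->.
have := cons _ nd; rewrite (demand_eq0 dD (onode_od M rs l d)).
move/eqP; rewrite subr_eq0 => /eqP.
rewrite /outflow (big_pred1 (obl rs (lift ord0 l))); last first.
  by move=> a /=; apply/eqP/eqP => /onode_out.
move=> ->; rewrite /inflow (bigD1 (qlink rs l)) /=; last first.
  by apply/eqP/onode_in; left.
rewrite addrC; congr (_ + _).
rewrite (big_pred1 (obl rs (widen_ord (leqnSn _) l))) // => a /=.
apply/andP/eqP => [[/eqP/onode_in[->|//]]|->]; first by rewrite eqxx.
by split; [apply/eqP/onode_in; right | rewrite eq_sym].
Qed.

Section NGEV.
Variables (K : cost_data R G) (P : ngev_data M).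

Definition reaches (d i : node G) : bool :=
  connect [rel j k | [exists a,
    [&& src a == j, tgt a == k & 0 < allocation P d a]]] i d.

(* e^{-theta (c_ij + s_jd)} is 0 when s_jd = +oo. *)
Definition choice_weight (c : flow) (s : node G -> node G -> \bar R)
    (d : node G) (a : link G) : R :=
  allocation P d a *
  fine (expeR (- ((scale P d (src a))%:E * ((c 0 a)%:E + s (tgt a) d))))%E.

(* At a node from which d cannot be reached this is 0 / 0, that is 0. *)
Definition choice_prob (c : flow) (s : node G -> node G -> \bar R)
    (d : node G) (a : link G) : R :=
  choice_weight c s d a / \sum_(b | src b == src a) choice_weight c s d b.

(* In an acyclic network a node may have no path to d along links with
   allocation > 0; then s i d = +oo.  The recursion for s i d is meaningless
   there, and the flow equation says that the node carries no flow to d. *)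
Definition ngev_equilibrium (c : flow) (xh : node G -> flow)
    (s : node G -> node G -> \bar R) : Prop :=
  [/\ Xhat xh /\ (Xagg `&` supply_feasible K) (aggregate xh),
      forall a, (c 0 a)%:E = link_cost K (aggregate xh) a,
      forall d i, d \in dests M ->
        (reaches d i -> s i d \is a fin_num) /\
        (~~ reaches d i -> s i d = +oo%E),
      forall d, d \in dests M -> s d d = 0%E &
      forall d i, d \in dests M -> i != d ->
        (reaches d i ->
           (1 = \sum_(a | src a == i) (allocation P d a)%:E *
              expeR (- ((scale P d i)%:E *
                         ((c 0 a)%:E + s (tgt a) d - s i d))))%E) /\
        forall a, src a = i ->
          xh d 0 a = choice_prob c s d a * outflow (xh d) i].

(* lne 0 = -oo and 0 * -oo = 0 give 0 ln 0 = 0; a positive flow on a link with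
   allocation 0 gives the value -oo. *)
Definition entropy (d : node G) (x : flow) : \bar R :=
  (- \sum_i ((scale P d i)^-1)%:E * \sum_(a | src a == i)
       (x 0 a)%:E * (lne (x 0 a / outflow x i)%:E
                      - lne (allocation P d a)%:E))%E.

(* H_d is only defined on nonnegative flows and is not differentiable where
   some link flow vanishes: its gradient is the vector of its right partial
   derivatives, with values in [-oo, +oo].  They are the usual partial
   derivatives at positive link flows, and, when H_d(x) is finite,
   +oo at a zero flow on a link with allocation > 0 leaving a node with
   outflow > 0. *)
Definition grad_entropy (d : node G) (x : flow) (a : link G) : \bar R :=
  lim (((t^-1)%:E * (entropy d (x + t *: delta_mx 0 a)%R - entropy d x))%E
         @[t --> (0 : R)^'+]).

(* The inner product is summed with the dual addition of extended reals,
   for which -oo + +oo = +oo: its only terms equal to +oo come from a flow of x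
   on a link with allocation 0, for which - H_d is itself +oo. *)
Definition VI_D (xh' : node G -> flow) : Prop :=
  [/\ Xhat xh' /\ (Xagg `&` supply_feasible K) (aggregate xh'),
      forall d, d \in dests M -> entropy d (xh' d) \is a fin_num &
      forall xh, Xhat xh -> (Xagg `&` supply_feasible K) (aggregate xh) ->
        (0%E <= (\sum_(d in dests M) \sum_(a : link G)
           (link_cost K (aggregate xh') a - grad_entropy d (xh' d) a)%E *
           (xh d 0 a - xh' d 0 a)%:E)%dE)%E].

(* The minimum over the compact set Xd is attained whenever it is finite. *)
Definition Hstar (d : node G) (c : flow) : \bar R :=
  ereal_inf [set ((dot c x)%:E - entropy d x)%E | x in Xd d].

Definition Hstar_differentiable (d : node G) (c : flow) : Prop :=
  (\forall c' \near c, Hstar d c' \is a fin_num) /\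
  differentiable (fine \o Hstar d : flow -> R) c.

(* cost_range need not be open; Hstar makes sense on all of R^|L|, and the
   gradient is that of a function on R^|L|. *)
Definition grad_Hstar (d : node G) (c : flow) : flow :=
  \row_a 'D_(delta_mx 0 a) (fine \o Hstar d : flow -> R) c.

Definition VI_C (c' : flow) : Prop :=
  [/\ cost_range K c',
      forall d, d \in dests M -> Hstar_differentiable d c' &
      forall c, cost_range K c ->
        0 <= dot (cost_inv K c' - \sum_(d in dests M) grad_Hstar d c')
                 (c - c')].

End NGEV.
End Demand.
End Model.

(* Main.v *)
Require Import Defs.
From HB Require Import structures.
From mathcomp Require Import all_boot all_order all_algebra.
From mathcomp Require Import all_classical all_reals all_analysis.
From mathcomp Require Import ring lra.

(** Fix link costs c and a destination d. Because the network is acyclic, the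
    recursion for the expected minimum costs s_id has exactly one solution, and
    it yields link choice probabilities q and, by pushing the demand downstream,
    a flow y(c), the loading [ngev_flow]. An equilibrium is therefore a family
    of flows x_d with x_d = y_d(C(sum of the x_d)) ([ngev_equilibriumP]), and
    each variational inequality is shown to say the same.

    Everything rests on one identity. Solving the logit formula for c gives
    c_ij = s_id - s_jd - (1/theta_i) (ln q_ij - ln alpha_ji), so for every x in
    X_d of finite entropy the potential differences telescope and
    c . x - H_d(x) = sum_i q_i^d s_id + sum_ij (x_ij/theta_i) ln (p_ij/q_ij),
    where p are the link shares of x ([cost_minus_entropy]). The last sum is a
    relative entropy, which is nonnegative and vanishes only for x = y(c).

    For [VI-D], the same substitution in C(x) - grad H_d(x) leaves, for the test
    direction y - x, minus the relative entropies of x and y with respect to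
    each other; the inequality forces both to vanish ([VI_D_ngev]). The gradient
    is infinite at the boundary of the cone of flows: the value +oo at an unused
    link of positive allocation forces x to be positive on all links that y
    uses, and the value -oo on links of allocation 0 makes the sum +oo for the
    test flows that use them. The test flow may be taken close to x, where it
    respects the capacities, as these are strict. Conversely, at an equilibrium
    C - grad H_d is a difference of potentials on every link that matters, and
    the sum is 0 ([ngev_VI_D]).

    For [VI-C], the identity gives H_d^*(c) = sum_i q_i^d s_id. As a minimum of
    affine functions of c, it has the supergradient y(c), which depends
    continuously on c; so it is differentiable with gradient y(c)
    ([served_differentiable], [grad_HstarE]). With x = C^{-1}(c) and w the sum of
    the loadings, the inequality reads (x - w) . (c' - c) >= 0 for all attainable
    costs c'. In the coordinates given by the queue loads each link cost is an
    increasing function of one coordinate. Lowering a single coordinate shows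
    x <= w, and then raising all flows shows x = w ([supply_VI_eq]), which is the
    fixed-point equation. *)

Set Implicit Arguments.
Unset Strict Implicit.
Unset Printing Implicit Defensive.

Import Order.TTheory GRing.Theory Num.Theory.
Import numFieldNormedType.Exports.

Local Open Scope classical_set_scope.
Local Open Scope ring_scope.

(** * Recursion and induction along an acyclic network *)

Section Acyclic.
Variable G : network.

Local Notation step :=
  [rel i j | [exists b, (@src G b == i) && (tgt b == j)]].

(** Heights for which every link goes down, resp. up: they turn recursions
    along the links into recursions on natural numbers. *)
Definition descendants (i : node G) : nat := #|[pred j | connect step i j]|.
Definition ancestors (i : node G) : nat := #|[pred j | connect step j i]|.

Lemma link_step (a : link G) : step (src a) (tgt a).
Proof. by apply/existsP; exists a; rewrite !eqxx. Qed.

Lemma descendants_lt (a : link G) : (descendants (tgt a) < descendants (src a))%N.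
Proof.
apply: proper_card; apply/properP; split.
  apply/fintype.subsetP => j; rewrite !inE => /(connect_trans _); apply.
  exact/connect1/link_step.
exists (src a); first by rewrite inE connect0.
by rewrite inE; exact: acyclic.
Qed.

Lemma ancestors_lt (a : link G) : (ancestors (src a) < ancestors (tgt a))%N.
Proof.
apply: proper_card; apply/properP; split.
  apply/fintype.subsetP => j; rewrite !inE => /connect_trans; apply.
  exact/connect1/link_step.
exists (tgt a); first by rewrite inE connect0.
by rewrite inE; exact: acyclic.
Qed.

Lemma downward_ind (Q : node G -> Prop) :
  (forall i, (forall a, src a = i -> Q (tgt a)) -> Q i) -> forall i, Q i.
Proof.
move=> IH i; have [n] := ubnP (descendants i); elim: n i => // n IHn i lein.
apply: IH => a ai; apply: IHn; rewrite -ltnS (leq_trans _ lein)// ltnS.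
by rewrite -ai descendants_lt.
Qed.

Lemma upward_ind (Q : node G -> Prop) :
  (forall i, (forall a, tgt a = i -> Q (src a)) -> Q i) -> forall i, Q i.
Proof.
move=> IH i; have [n] := ubnP (ancestors i); elim: n i => // n IHn i lein.
apply: IH => a ai; apply: IHn; rewrite -ltnS (leq_trans _ lein)// ltnS.
by rewrite -ai ancestors_lt.
Qed.

(** An equation that determines the value at each node from the values at nodes
    of smaller height is solved by iterating it once per height level,
    whatever the starting point. *)
Lemma iter_fixpoint (A : Type) (h : node G -> nat)
    (T : (node G -> A) -> node G -> A) (f0 : node G -> A) (N : nat) :
  (forall f g i, (forall j, (h j < h i)%N -> f j = g j) -> T f i = T g i) ->
  (forall i, (h i <= N)%N) -> (forall i, (0 < h i)%N) ->
  forall i, T (iter N T f0) i = iter N T f0 i.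
Proof.
move=> locT hN h0 i; have := hN i; move: N {hN} i.
elim=> [|N IH] i hi; first by move: (h0 i); rewrite ltnNge hi.
rewrite iterS; apply: locT => j hj; apply: IH.
by rewrite -ltnS (leq_trans hj).
Qed.

Lemma descendants_gt0 i : (0 < descendants i)%N.
Proof. by apply/card_gt0P; exists i; rewrite inE connect0. Qed.

Lemma ancestors_gt0 i : (0 < ancestors i)%N.
Proof. by apply/card_gt0P; exists i; rewrite inE connect0. Qed.

End Acyclic.

(** * Gibbs' inequality *)

Section Gibbs.
Variables (R : realType) (I : finType) (A : pred I) (x q : I -> R).
Hypothesis x_ge0 : forall i, A i -> 0 <= x i.
Hypothesis q_ge0 : forall i, A i -> 0 <= q i.
Hypothesis q_gt0 : forall i, A i -> 0 < x i -> 0 < q i.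
Hypothesis q_sum1 : \sum_(i | A i) q i = 1.
Let X := \sum_(i | A i) x i.

Lemma ln_lt_sub1 (t : R) : 0 < t -> t != 1 -> ln t < t - 1.
Proof.
move=> t0 t1; have lnt0 : ln t != 0 by rewrite ln_eq0.
by have := expR_gt1Dx lnt0; rewrite lnK ?posrE// ltrBrDl.
Qed.

Lemma ln_le_sub1 (t : R) : 0 < t -> ln t <= t - 1.
Proof.
by move=> t0; have [->|/(ln_lt_sub1 t0)/ltW//] := eqVneq t 1; rewrite ln1 subrr.
Qed.

Lemma le_term_sum i : A i -> x i <= X.
Proof.
move=> Ai; rewrite /X (bigD1 i)//= lerDl; apply: sumr_ge0 => j /andP[Aj _].
exact: x_ge0.
Qed.

(** With t = X q / x, the gap in each term is that in ln t <= t - 1. *)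
Lemma gibbs_termP i : A i -> 0 < x i ->
  exists2 t, 0 < t &
    x i - X * q i = x i * - (t - 1) /\
    x i * (ln (x i / X) - ln (q i)) = x i * - ln t.
Proof.
move=> Ai xi0; have X0 : 0 < X by apply: lt_le_trans xi0 (le_term_sum Ai).
have qi0 := q_gt0 Ai xi0; exists (X * q i / x i).
  by rewrite divr_gt0// mulr_gt0.
split; first by field; rewrite gt_eqF.
by rewrite !ln_div ?lnM ?posrE ?mulr_gt0//; ring.
Qed.

Lemma gibbs_term i : A i -> x i - X * q i <= x i * (ln (x i / X) - ln (q i)).
Proof.
move=> Ai; have := x_ge0 Ai; rewrite le_eqVlt => /predU1P[x0|xi0].
  rewrite -x0 mul0r sub0r oppr_le0 mulr_ge0 ?q_ge0//; apply: sumr_ge0.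
  exact: x_ge0.
have [t t0 [-> ->]] := gibbs_termP Ai xi0.
by rewrite ler_pM2l// lerN2 ln_le_sub1.
Qed.

(** The linear lower bounds of the terms add up to X - X = 0. *)
Lemma gibbs_ge0 : 0 <= \sum_(i | A i) x i * (ln (x i / X) - ln (q i)).
Proof.
apply: le_trans (_ : \sum_(i | A i) (x i - X * q i) <= _).
  by rewrite sumrB -mulr_sumr q_sum1 mulr1 subrr.
exact: ler_sum gibbs_term.
Qed.

(** ln t = t - 1 only at t = 1. *)
Lemma gibbs_eq0 : \sum_(i | A i) x i * (ln (x i / X) - ln (q i)) = 0 ->
  forall i, A i -> x i = X * q i.
Proof.
move=> sum0 i Ai.
have /psumr_eq0P/(_ i Ai) : \sum_(i | A i)
    (x i * (ln (x i / X) - ln (q i)) - (x i - X * q i)) = 0.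
  by rewrite !sumrB -mulr_sumr q_sum1 mulr1 subrr sum0 subr0.
move=> term0; have {term0} /subr0_eq := term0 (fun j Aj =>
  etrans (subr_ge0 _ _) (gibbs_term Aj)).
have := x_ge0 Ai; rewrite le_eqVlt => /predU1P[x0|xi0].
  by rewrite -x0 mul0r sub0r => /eqP; rewrite eq_sym oppr_eq0 => /eqP.
have [t t0 [eqx ->]] := gibbs_termP Ai xi0.
apply: contraPP => /eqP; rewrite -subr_eq0 eqx mulf_eq0 negb_or oppr_eq0 subr_eq0.
move=> /andP[_ t1]; apply/eqP; rewrite gt_eqF// ltr_pM2l// ltrN2.
exact: ln_lt_sub1.
Qed.

End Gibbs.

(** * The NGEV model at fixed link costs *)

Section LogitLoading.
Variables (R : realType) (G : network) (M : demand_data R G) (P : ngev_data M).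
Variable d : node G.
Hypothesis dD : d \in dests M.
Local Notation flow := 'rV[R]_(nlinks G).
Local Notation alpha := (allocation P d).
Local Notation theta := (scale P d).
Local Notation reach := (reaches P d).

Implicit Types (c x : flow) (s : node G -> R) (i : node G) (a : link G).

Let theta_gt0 i : 0 < theta i. Proof. exact: scale_gt0. Qed.

(** The links that can carry flow to d: a flow leaving d never returns, and one
    that enters a node from which d is out of reach has to cross a link of
    allocation 0. *)
Definition usable a := [&& 0 < alpha a, reach (tgt a) & src a != d].

Lemma reach_src a : 0 < alpha a -> reach (tgt a) -> reach (src a).
Proof.
move=> a0; apply/connect_trans/connect1.
by apply/existsP; exists a; rewrite !eqxx.
Qed.

Lemma usable_src a : usable a -> reach (src a).
Proof. by case/and3P => a0 /(reach_src a0). Qed.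

Lemma reach_usable i : reach i -> i != d -> exists2 a, src a = i & usable a.
Proof.
case/connectP => -[|j p] /=; first by move=> _ ->; rewrite eqxx.
case/andP => /existsP[a /and3P[/eqP <- /eqP <- a0]] ap dlast srcd.
by exists a => //; rewrite /usable a0 srcd andbT; apply/connectP; exists p.
Qed.

Definition weight c s a : R :=
  if usable a then alpha a * expR (- (theta (src a) * (c 0 a + s (tgt a))))
  else 0.

Definition total_weight c s i := \sum_(a | src a == i) weight c s a.

(** At nodes with no usable link, in particular at d, the sum is 0, and so is
    the value, because ln 0 = 0. *)
Definition emc_step c s i := - ((theta i)^-1 * ln (total_weight c s i)).

(** The expected minimum costs to d, at the nodes from which d can be reached,
    and 0 elsewhere. One iteration per level of the network suffices. *)
Definition emc c := iter #|node G| (emc_step c) (fun=> 0).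

Lemma eq_total_weight c s s' i :
  (forall a, src a = i -> s (tgt a) = s' (tgt a)) ->
  total_weight c s i = total_weight c s' i.
Proof.
by move=> ss'; apply: eq_bigr => a /eqP ai; rewrite /weight ss'.
Qed.

Lemma emcE c i : emc c i = emc_step c (emc c) i.
Proof.
apply/esym/(@iter_fixpoint _ _ (@descendants G)) => [s s' j ss'|j|j].
- rewrite /emc_step (@eq_total_weight _ _ s')// => a aj; apply: ss'.
  by rewrite -aj descendants_lt.
- exact: max_card.
- exact: descendants_gt0.
Qed.

Lemma emc_unique c s : (forall i, s i = emc_step c s i) -> s =1 emc c.
Proof.
move=> sE; apply: downward_ind => i IH.
by rewrite sE emcE /emc_step (@eq_total_weight _ _ (emc c)).
Qed.

Lemma weight_ge0 c s a : 0 <= weight c s a.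
Proof.
rewrite /weight; case: ifP => // /andP[a0 _].
by rewrite mulr_ge0 ?expR_ge0// ltW.
Qed.

Lemma weight_gt0 c s a : usable a -> 0 < weight c s a.
Proof.
by move=> ua; rewrite /weight ua; case/andP: ua => a0 _; rewrite mulr_gt0 ?expR_gt0.
Qed.

Lemma total_weight_usable c s a : usable a -> 0 < total_weight c s (src a).
Proof.
move=> ua; apply: lt_le_trans (weight_gt0 c s ua) _.
by rewrite /total_weight (bigD1 a)//= lerDl; apply: sumr_ge0 => b _;
  exact: weight_ge0.
Qed.

Lemma total_weight_gt0 c s i : reach i -> i != d -> 0 < total_weight c s i.
Proof. by move=> ri /(reach_usable ri)[a <-]; exact: total_weight_usable. Qed.

Lemma total_weight0 c s i : ~~ (reach i && (i != d)) -> total_weight c s i = 0.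
Proof.
move=> nri; apply: big1 => a /eqP ai; rewrite /weight ifN//.
apply: contra nri => ua; rewrite -ai (usable_src ua).
by case/and3P: ua.
Qed.

Lemma emc0 c i : ~~ (reach i && (i != d)) -> emc c i = 0.
Proof. by move=> nri; rewrite emcE /emc_step total_weight0// ln0// mulr0 oppr0. Qed.

Lemma emc_dest c : emc c d = 0.
Proof. by rewrite emc0// eqxx andbF. Qed.

Definition prob c a := weight c (emc c) a / total_weight c (emc c) (src a).

Lemma prob0 c a : ~~ usable a -> prob c a = 0.
Proof. by rewrite /prob /weight => /negbTE ->; rewrite mul0r. Qed.

Lemma prob_gt0 c a : usable a -> 0 < prob c a.
Proof. by move=> ua; rewrite divr_gt0 ?weight_gt0 ?total_weight_usable. Qed.

Lemma prob_ge0 c a : 0 <= prob c a.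
Proof.
by have [/prob_gt0/ltW|/prob0 ->] := boolP (usable a).
Qed.

Lemma prob_sum1 c i : reach i -> i != d -> \sum_(a | src a == i) prob c a = 1.
Proof.
move=> ri id; rewrite -[RHS](@divff _ (total_weight c (emc c) i)); last first.
  by rewrite gt_eqF// total_weight_gt0.
by rewrite mulr_suml; apply: eq_bigr => a /eqP <-.
Qed.

(** Solving the logit formula for the cost: up to the logarithmic term, link
    costs are the differences of a potential, whose sum along any flow to d is
    fixed by the demand. *)
Lemma cost_emc c a : usable a ->
  c 0 a = emc c (src a) - emc c (tgt a)
          - (theta (src a))^-1 * (ln (prob c a) - ln (alpha a)).
Proof.
move=> ua; have t0 := total_weight_usable c (emc c) ua.
rewrite ln_div ?posrE ?weight_gt0// {1}/weight ua.
have a0 : 0 < alpha a by case/andP: ua.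
rewrite lnM ?posrE ?expR_gt0// expRK [emc c (src a)]emcE /emc_step.
by field; rewrite gt_eqF.
Qed.

(** The flow to d through each node, origin demand included; the value at d is
    immaterial, as no link leaving d is usable. *)
Definition node_flow_step c (f : node G -> R) i :=
  demand M d i + \sum_(a | tgt a == i) prob c a * f (src a).
Definition node_flow c := iter #|node G| (node_flow_step c) (fun=> 0).

Definition ngev_flow c : flow := \row_a (prob c a * node_flow c (src a)).

Lemma eq_node_flow_step c f g i :
  (forall a, tgt a = i -> f (src a) = g (src a)) ->
  node_flow_step c f i = node_flow_step c g i.
Proof. by move=> fg; congr +%R; apply: eq_bigr => a /eqP ai; rewrite fg. Qed.

Lemma node_flowE c i : node_flow c i = node_flow_step c (node_flow c) i.
Proof.
apply/esym/(@iter_fixpoint _ _ (@ancestors G)) => [f g j fg|j|j].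
- by apply: eq_node_flow_step => a aj; apply: fg; rewrite -aj ancestors_lt.
- exact: max_card.
- exact: ancestors_gt0.
Qed.

Lemma demand_ge0 i : 0 <= demand M d i.
Proof.
have [/(demand_gt0 dD)/ltW//|/(demand_eq0 dD) ->//] := boolP ((i, d) \in od_pair M).
Qed.

Lemma node_flow_ge0 c i : 0 <= node_flow c i.
Proof.
elim/upward_ind: i => i IH; rewrite node_flowE addr_ge0 ?demand_ge0//.
by apply: sumr_ge0 => a /eqP ai; rewrite mulr_ge0 ?prob_ge0 ?IH.
Qed.

Lemma ngev_flow_ge0 c a : 0 <= ngev_flow c 0 a.
Proof. by rewrite mxE mulr_ge0 ?prob_ge0 ?node_flow_ge0. Qed.

Lemma ngev_flow_usable c a : ngev_flow c 0 a != 0 -> usable a.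
Proof. by apply: contraNT => /prob0 pa0; rewrite mxE pa0 mul0r. Qed.

Lemma node_flow_inflow c i : node_flow c i = demand M d i + inflow (ngev_flow c) i.
Proof.
by rewrite node_flowE; congr +%R; apply: eq_bigr => a _; rewrite mxE.
Qed.

(** Otherwise no flow to d of finite entropy meets the demand. *)
Definition served := forall i, i != d -> 0 < demand M d i -> reach i.

Lemma node_flow_unreach c i : served -> i != d -> ~~ reach i -> node_flow c i = 0.
Proof.
move=> srv id nri; rewrite node_flowE /node_flow_step big1 ?addr0; last first.
  move=> a /eqP ai; rewrite prob0 ?mul0r// /usable ai (negbTE nri) andbF//.
apply/eqP; rewrite eq_le demand_ge0 andbT leNgt.
by apply: contra nri => /(srv _ id).
Qed.

Lemma outflow_ngev c i : served -> i != d ->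
  outflow (ngev_flow c) i = node_flow c i.
Proof.
move=> srv id; have [ri|nri] := boolP (reach i).
  rewrite -[RHS]mul1r -(prob_sum1 c ri id) mulr_suml.
  by apply: eq_bigr => a /eqP ai; rewrite mxE ai.
rewrite node_flow_unreach//; apply: big1 => a /eqP ai.
by rewrite mxE ai node_flow_unreach// mulr0.
Qed.

Lemma ngev_flow_Xd c : served -> Xd M d (ngev_flow c).
Proof.
move=> srv; split=> [|i id]; first exact: ngev_flow_ge0.
by rewrite outflow_ngev// node_flow_inflow addrK.
Qed.

Lemma ngev_flow_prob c a : served ->
  ngev_flow c 0 a = prob c a * outflow (ngev_flow c) (src a).
Proof.
move=> srv; have [/and3P[_ _ ad]|/prob0 pa0] := boolP (usable a).
  by rewrite outflow_ngev// mxE.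
by rewrite mxE pa0 !mul0r.
Qed.

(** Choice probabilities and conservation determine the flow from the origins
    downstream. *)
Lemma ngev_flow_unique c x : Xd M d x ->
  (forall a, x 0 a = prob c a * outflow x (src a)) -> x = ngev_flow c.
Proof.
move=> [x0 xcons] xE.
have prob_eq a : (src a != d -> outflow x (src a) = node_flow c (src a)) ->
    prob c a * outflow x (src a) = prob c a * node_flow c (src a).
  have [/and3P[_ _ ad]/(_ ad) ->//|/prob0 ->] := boolP (usable a).
  by rewrite !mul0r.
suff outE i : i != d -> outflow x i = node_flow c i.
  by apply/rowP => a; rewrite xE mxE; apply: prob_eq; exact: outE.
elim/upward_ind: i => i IH id; rewrite node_flowE /node_flow_step -xcons//.
rewrite -addrA -[LHS]addr0; congr +%R; apply/esym/eqP; rewrite addrC subr_eq0.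
apply/eqP; apply: eq_bigr => a /eqP ai; rewrite xE; apply/esym/prob_eq => ad.
exact: IH.
Qed.

(** Links with allocation 0 are those that make the entropy -oo. *)
Definition supported x := forall a, 0 < x 0 a -> 0 < alpha a.

Lemma le_outflow x a : (forall b, 0 <= x 0 b) -> x 0 a <= outflow x (src a).
Proof. by move=> x0; apply: (@le_term_sum _ _ _ (fun b => x 0 b)). Qed.

Lemma le_inflow x a : (forall b, 0 <= x 0 b) -> x 0 a <= inflow x (tgt a).
Proof.
by move=> x0; apply: (@le_term_sum _ _ (fun b => tgt b == tgt a) (fun b => x 0 b)).
Qed.

(** The network being acyclic, positive flow can be followed downstream until it
    ends, which it can only do at d. *)
Lemma flow_connect (e : rel (node G)) x i : Xd M d x ->
  (forall a, 0 < x 0 a -> e (src a) (tgt a)) ->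
  i != d -> 0 < outflow x i -> connect e i d.
Proof.
move=> [x0 xcons] xe; elim/downward_ind: i => i IH id.
rewrite lt0r => /andP[/eqP out0 _].
have [a /andP[/eqP ai xa0]] : exists a, (src a == i) && (0 < x 0 a).
  by apply: psumr_neq0P out0 => b _; exact: x0.
rewrite -ai; apply: connect_trans (connect1 (xe _ xa0)) _.
have [->|td] := eqVneq (tgt a) d; first exact: connect0.
apply: (IH a ai td); have /eqP := xcons _ td; rewrite subr_eq => /eqP ->.
rewrite ltr_wpDl ?demand_ge0//; exact: lt_le_trans xa0 (le_inflow a x0).
Qed.

Lemma flow_connect_tgt (e : rel (node G)) x a : Xd M d x ->
  (forall a, 0 < x 0 a -> e (src a) (tgt a)) ->
  0 < x 0 a -> connect e (tgt a) d.
Proof.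
move=> xX xe xa0; have [x0 xcons] := xX.
have [->|td] := eqVneq (tgt a) d; first exact: connect0.
apply: (flow_connect xX xe td).
have /eqP := xcons _ td; rewrite subr_eq => /eqP ->.
rewrite ltr_wpDl ?demand_ge0//; exact: lt_le_trans xa0 (le_inflow a x0).
Qed.

(** Flow conservation is not imposed at d, but a flow leaving d would have to
    come back to d. *)
Lemma Xd_dest_out x a : Xd M d x -> src a = d -> x 0 a = 0.
Proof.
move=> xX srcd; apply/eqP; rewrite eq_le xX.1 andbT leNgt.
apply: contra (acyclic a) => xa0; rewrite srcd.
by apply: flow_connect_tgt (xX) _ xa0 => b _; exact: link_step.
Qed.

Lemma supported_step x a : supported x -> 0 < x 0 a ->
  [exists b, [&& src b == src a, tgt b == tgt a & 0 < alpha b]].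
Proof. by move=> supp xa0; apply/existsP; exists a; rewrite !eqxx supp. Qed.

Lemma supported_usable x a : Xd M d x -> supported x -> 0 < x 0 a -> usable a.
Proof.
move=> xX supp xa0; rewrite /usable supp//=; apply/andP; split.
  by apply: flow_connect_tgt (xX) _ xa0 => b; exact: supported_step.
apply: contraTneq xa0 => /(Xd_dest_out xX) ->; by rewrite ltxx.
Qed.

Lemma supported_served x : Xd M d x -> supported x -> served.
Proof.
move=> xX supp i id dem0.
apply: (flow_connect xX _ id) => [a|]; first exact: supported_step.
case: xX => x0 /(_ i id)/eqP; rewrite subr_eq => /eqP ->.
by rewrite ltr_pwDl//; apply: sumr_ge0 => a _; exact: x0.
Qed.

Lemma ngev_flow_supported c : supported (ngev_flow c).
Proof. by move=> a; rewrite lt0r => /andP[/ngev_flow_usable/andP[]]. Qed.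

Lemma circulation x s :
  \sum_a x 0 a * (s (src a) - s (tgt a)) =
  \sum_i s i * (outflow x i - inflow x i).
Proof.
under eq_bigr do rewrite mulrBr.
under [RHS]eq_bigr do rewrite mulrBr.
rewrite !sumrB; congr (_ - _).
  rewrite (partition_big (@src G) predT)//=; apply: eq_bigr => i _.
  by rewrite mulr_sumr; apply: eq_bigr => a /eqP ->; rewrite mulrC.
rewrite (partition_big (@tgt G) predT)//=; apply: eq_bigr => i _.
by rewrite mulr_sumr; apply: eq_bigr => a /eqP ->; rewrite mulrC.
Qed.

Lemma circulation_Xd x s : Xd M d x -> s d = 0 ->
  \sum_a x 0 a * (s (src a) - s (tgt a)) = \sum_(i | i != d) s i * demand M d i.
Proof.
move=> [_ xcons] sd; rewrite circulation (bigD1 d)//= sd mul0r add0r.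
by apply: eq_bigr => i /xcons ->.
Qed.

(** The entropy as a real number, for flows on which it is finite. *)
Definition rentropy x :=
  - \sum_a (theta (src a))^-1 *
      (x 0 a * (ln (x 0 a / outflow x (src a)) - ln (alpha a))).

(** The relative entropy of the link shares of x with respect to the logit
    probabilities, weighted by the flow through each node. *)
Definition divergence c x :=
  \sum_a (theta (src a))^-1 *
    (x 0 a * (ln (x 0 a / outflow x (src a)) - ln (prob c a))).

(** Substituting [cost_emc] for the costs, the potential differences telescope
    along the flow. So the minimum over x is the demand-weighted sum of expected
    minimum costs, attained when the link shares are the logit probabilities. *)
Lemma cost_minus_entropy c x : Xd M d x -> supported x ->
  dot c x - rentropy x =
  \sum_(i | i != d) emc c i * demand M d i + divergence c x.
Proof.
move=> xX supp; rewrite -(circulation_Xd xX (emc_dest c)) opprK.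
rewrite -!big_split /=; apply: eq_bigr => a _.
have := xX.1 a; rewrite le_eqVlt => /predU1P[<-|xa0].
  by rewrite !mul0r !mulr0.
rewrite {1}(cost_emc c (supported_usable xX supp xa0)); ring.
Qed.

Lemma outflow_unreach x a i : Xd M d x -> supported x ->
  ~~ (reach i && (i != d)) -> src a = i -> x 0 a = 0.
Proof.
move=> xX supp nri ai; apply/eqP; rewrite eq_le xX.1 andbT leNgt.
apply: contra nri => /(supported_usable xX supp) ua; rewrite -ai (usable_src ua).
by case/and3P: ua.
Qed.

Definition node_divergence c x i :=
  \sum_(a | src a == i) x 0 a * (ln (x 0 a / outflow x i) - ln (prob c a)).

Lemma divergenceE c x :
  divergence c x = \sum_i (theta i)^-1 * node_divergence c x i.
Proof.
rewrite /divergence (partition_big (@src G) predT)//=; apply: eq_bigr => i _.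
by rewrite mulr_sumr; apply: eq_bigr => a /eqP ->.
Qed.

Lemma node_divergence_ge0 c x i : Xd M d x -> supported x ->
  0 <= node_divergence c x i.
Proof.
move=> xX supp; have [/andP[ri id]|nri] := boolP (reach i && (i != d)).
  apply: gibbs_ge0 => [a _|a _|a _ xa0|]; last exact: prob_sum1.
  - exact: xX.1.
  - exact: prob_ge0.
  - exact/prob_gt0/(supported_usable xX).
rewrite /node_divergence big1// => a /eqP ai.
by rewrite (outflow_unreach xX supp nri ai) mul0r.
Qed.

Lemma scaled_divergence_ge0 c x i : Xd M d x -> supported x ->
  0 <= (theta i)^-1 * node_divergence c x i.
Proof.
by move=> xX supp; rewrite mulr_ge0 ?invr_ge0 ?(ltW (theta_gt0 i))//
  node_divergence_ge0.
Qed.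

Lemma divergence_ge0 c x : Xd M d x -> supported x -> 0 <= divergence c x.
Proof.
move=> xX supp; rewrite divergenceE; apply: sumr_ge0 => i _.
exact: scaled_divergence_ge0.
Qed.

Lemma divergence_eq0 c x : Xd M d x -> supported x -> divergence c x = 0 ->
  forall a, x 0 a = prob c a * outflow x (src a).
Proof.
move=> xX supp; rewrite divergenceE => div0 a.
have [/andP[ri id]|nri] := boolP (reach (src a) && (src a != d)); last first.
  rewrite (outflow_unreach xX supp nri)// prob0 ?mul0r//.
  apply: contra nri => ua; rewrite (usable_src ua).
  by case/and3P: ua.
have /eqP : (theta (src a))^-1 * node_divergence c x (src a) = 0.
  by apply: (psumr_eq0P _ div0) => // i _; exact: scaled_divergence_ge0.
rewrite mulf_eq0 invr_eq0 (gt_eqF (theta_gt0 _)) /= => /eqP node0.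
rewrite mulrC; apply: (gibbs_eq0 (A := fun b => src b == src a)
  (x := fun b => x 0 b) _ _ _ _ node0 (eqxx _)) => [b _|b _|b _ xb0|].
- exact: xX.1.
- exact: prob_ge0.
- exact/prob_gt0/(supported_usable xX).
- exact: prob_sum1.
Qed.

(** Also at links without flow, where the share 0 / 0 need not be [prob]. *)
Lemma share_prob c x a : Xd M d x -> (forall b, x 0 b = prob c b * outflow x (src b)) ->
  x 0 a * (ln (x 0 a / outflow x (src a)) - ln (prob c a)) = 0.
Proof.
move=> [x0 _] xE; have := x0 a; rewrite le_eqVlt => /predU1P[<-|xa0].
  by rewrite mul0r.
rewrite {2}xE mulfK ?subrr ?mulr0// gt_eqF//.
exact: lt_le_trans xa0 (le_outflow a x0).
Qed.

Lemma divergence_ngev c : served -> divergence c (ngev_flow c) = 0.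
Proof.
move=> srv; apply: big1 => a _; rewrite share_prob ?mulr0//.
  exact: ngev_flow_Xd.
by move=> b; exact: ngev_flow_prob.
Qed.

End LogitLoading.

(** * Equilibrium as a fixed point of the logit loading *)

Section Equilibrium.
Variables (R : realType) (G : network) (K : cost_data R G).
Variables (M : demand_data R G) (P : ngev_data M).
Local Notation flow := 'rV[R]_(nlinks G).

Definition ecost (c : flow) (i d : node G) : \bar R :=
  if reaches P d i then (emc P d c i)%:E else +oo%E.

Section Destination.
Variable d : node G.
Hypothesis dD : d \in dests M.
Local Notation alpha := (allocation P d).
Local Notation theta := (scale P d).

Let theta_gt0 i : 0 < theta i. Proof. exact: scale_gt0. Qed.

Implicit Types (c : flow) (s : node G -> node G -> \bar R) (sigma : node G -> R).

Definition represents s sigma :=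
  forall i, s i d = if reaches P d i then (sigma i)%:E else +oo%E.

(** The case +oo of s is matched by the convention that unusable links have
    weight 0. The term u stands for s_id in the recursion. *)
Lemma expeR_link c s sigma a (u : R) : represents s sigma -> src a != d ->
  ((alpha a)%:E * expeR (- ((theta (src a))%:E *
     ((c 0 a)%:E + s (tgt a) d - u%:E))) =
   (expR (theta (src a) * u) * weight P d c sigma a)%:E)%E.
Proof.
move=> sE ad; rewrite /weight /usable ad andbT sE.
have [a0|] := boolP (0 < alpha a); last first.
  rewrite lt0r allocation_ge0// andbT negbK => /eqP ->.
  by rewrite mul0e /= mulr0.
case: ifP => rt /=.
  rewrite -EFinM; congr (_%:E); rewrite mulrCA -expRD; congr (_ * expR _); ring.
by rewrite gt0_muley ?lte_fin// mulr0 /= mule0.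
Qed.

Lemma choice_weightE c s sigma a : represents s sigma -> src a != d ->
  choice_weight P c s d a = weight P d c sigma a.
Proof.
move=> sE ad; rewrite /choice_weight /weight /usable ad andbT sE.
have [a0|] := boolP (0 < alpha a); last first.
  by rewrite lt0r allocation_ge0// andbT negbK => /eqP ->; rewrite mul0r.
by case: ifP => rt //=; rewrite gt0_muley ?lte_fin//= mulr0.
Qed.

(** The normalization 1 = exp (theta sigma_i) * total weight, solved for
    sigma_i. *)
Lemma recursionE c s sigma i : represents s sigma -> reaches P d i -> i != d ->
  (1 = \sum_(a | src a == i) (allocation P d a)%:E *
        expeR (- ((scale P d i)%:E * ((c 0 a)%:E + s (tgt a) d - s i d))))%E
  <-> sigma i = emc_step P d c sigma i.
Proof.
move=> sE ri id.
have -> : (\sum_(a | src a == i) (allocation P d a)%:E *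
        expeR (- ((scale P d i)%:E * ((c 0 a)%:E + s (tgt a) d - s i d))) =
    (expR (theta i * sigma i) * total_weight P d c sigma i)%:E)%E.
  rewrite mulr_sumr -sumEFin; apply: eq_bigr => a /eqP ai.
  by rewrite -ai in ri id *; rewrite -(expeR_link _ _ sE id) (sE (src a)) ri.
have t0 := total_weight_gt0 c sigma ri id.
rewrite /emc_step; split=> [[]|->].
  move=> /(congr1 (@ln R)); rewrite ln1 lnM ?posrE ?expR_gt0// expRK => /eqP.
  rewrite eq_sym addr_eq0 => /eqP e; rewrite -mulrN -e mulKf// gt_eqF//.
congr (_%:E); rewrite mulrN mulVKf ?gt_eqF// expRN lnK ?posrE// mulVf//.
by rewrite gt_eqF.
Qed.

Lemma represents_emc c : represents (ecost c) (emc P d c).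
Proof. by []. Qed.

Lemma emc_of_recursion c s :
  (forall i, (reaches P d i -> s i d \is a fin_num) /\
             (~~ reaches P d i -> s i d = +oo%E)) ->
  s d d = 0%E ->
  (forall i, i != d -> reaches P d i ->
    (1 = \sum_(a | src a == i) (allocation P d a)%:E *
          expeR (- ((scale P d i)%:E * ((c 0 a)%:E + s (tgt a) d - s i d))))%E) ->
  represents s (emc P d c).
Proof.
move=> sfin sdd srec.
pose sigma i : R := if reaches P d i then fine (s i d) else 0.
have sE : represents s sigma.
  move=> i; rewrite /sigma; have [+ +] := sfin i.
  by case: (reaches P d i) => [/(_ isT)/fineK -> //|_ /(_ isT) ->].
suff sigmaE : sigma =1 emc P d c by move=> i; rewrite sE sigmaE.
apply: emc_unique => i.
have [/andP[ri id]|nri] := boolP (reaches P d i && (i != d)).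
  by apply/(recursionE c sE ri id)/srec.
rewrite /emc_step total_weight0// ln0// mulr0 oppr0.
move: nri; rewrite negb_and negbK /sigma => /orP[/negbTE -> //|/eqP ->].
by rewrite sdd /=; case: ifP.
Qed.

Lemma choice_probE c s a : represents s (emc P d c) -> src a != d ->
  choice_prob P c s d a = prob P d c a.
Proof.
move=> sE ad; rewrite /choice_prob (choice_weightE _ sE ad); congr (_ / _).
by apply: eq_bigr => b /eqP ba; rewrite (choice_weightE _ sE)// ba.
Qed.

End Destination.

Lemma link_cost_cost x : supply_feasible K x ->
  forall a, (cost K x 0 a)%:E = link_cost K x a.
Proof. by move=> [_ fin] a; rewrite mxE fineK. Qed.

(** The expected minimum costs are determined by the link costs, and then the
    flows by the probabilities: an equilibrium is a fixed point of link costs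
    to loading to link costs. Both variational inequalities are compared with
    this form. *)
Lemma ngev_equilibriumP c xh : (exists s, ngev_equilibrium K P c xh s) <->
  [/\ Xhat M xh, supply_feasible K (aggregate M xh), c = cost K (aggregate M xh)
    & forall d, d \in dests M -> xh d = ngev_flow P d c].
Proof.
split=> [[s [[xhX [_ xhY]] cE sfin sdd seq]]|[xhX xhY cE xhE]].
  split=> // [|d dD].
    by apply/rowP => a; apply: EFin_inj; rewrite link_cost_cost.
  have sE : represents d s (emc P d c).
    apply: (emc_of_recursion dD) => [i||i id ri]; first exact: sfin.
      exact: sdd.
    by have [/(_ ri)] := seq d i dD id.
  have xE a : src a != d ->
      xh d 0 a = prob P d c a * outflow (xh d) (src a).
    by move=> ad; rewrite -(choice_probE dD sE ad); have [_] := seq d _ dD ad; apply.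
  apply: (ngev_flow_unique (xhX _ dD)) => a.
  have [ad|/xE//] := eqVneq (src a) d.
  rewrite (Xd_dest_out dD (xhX _ dD) ad) prob0 ?mul0r//.
  by rewrite /usable ad eqxx !andbF.
exists (ecost c); split=> //.
- by split=> //; split=> //; exists xh.
- by move=> a; rewrite cE link_cost_cost.
- by move=> d i dD; rewrite /ecost; split; [move=> -> | move=> /negbTE ->].
- by move=> d dD; rewrite /ecost /reaches connect0 emc_dest.
move=> d i dD id; split=> [ri|a ai].
  by apply/(recursionE dD c (@represents_emc d c) ri id)/emcE.
rewrite (choice_probE dD (@represents_emc d c)) ?ai//.
have xX := xhX _ dD; rewrite (xhE _ dD) in xX *.
have srv := supported_served dD xX (ngev_flow_supported (c := c)).
by rewrite -ai -ngev_flow_prob.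
Qed.

End Equilibrium.

(** * The entropy and its gradient *)

Local Arguments lne {R} x : simpl never.

Section Entropy.
Variables (R : realType) (G : network) (M : demand_data R G) (P : ngev_data M).
Variable d : node G.
Hypothesis dD : d \in dests M.
Local Notation flow := 'rV[R]_(nlinks G).
Local Notation alpha := (allocation P d).
Local Notation theta := (scale P d).
Implicit Types (x : flow) (i : node G) (a : link G).

Let theta_gt0 i : 0 < theta i. Proof. exact: scale_gt0. Qed.

Lemma outflow_gt0 x a : (forall b, 0 <= x 0 b) -> 0 < x 0 a -> 0 < outflow x (src a).
Proof. by move=> x0 xa0; apply: lt_le_trans xa0 (le_outflow a x0). Qed.

Lemma share_gt0 x a : (forall b, 0 <= x 0 b) -> 0 < x 0 a ->
  0 < x 0 a / outflow x (src a).
Proof. by move=> x0 xa0; rewrite divr_gt0// outflow_gt0. Qed.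

Lemma entropyE x : (forall a, 0 <= x 0 a) -> supported P d x ->
  entropy P d x = (rentropy P d x)%:E.
Proof.
move=> x0 supp; rewrite /entropy /rentropy EFinN; congr (- _)%E.
rewrite (partition_big (@src G) predT)//= -sumEFin; apply: eq_bigr => i _.
under [in RHS]eq_bigr => a /eqP -> do [].
rewrite -mulr_sumr EFinM; congr (_ * _)%E.
rewrite -sumEFin; apply: eq_bigr => a /eqP ai.
have := x0 a; rewrite le_eqVlt => /predU1P[<-|xa0].
  by rewrite !mul0e !mul0r.
by rewrite -ai !lne_EFin ?supp// share_gt0.
Qed.

(** A flow on a link of allocation 0 contributes +oo to the sum, and no term is
    -oo, because ln 0 is only met with the factor 0. *)
Lemma entropyNy x a : (forall b, 0 <= x 0 b) -> 0 < x 0 a -> ~~ (0 < alpha a) ->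
  entropy P d x = -oo%E.
Proof.
move=> x0 xa0 na0.
have termNNy b : ((x 0 b)%:E * (lne (x 0 b / outflow x (src b))%:E
    - lne (alpha b)%:E) != -oo)%E.
  have := x0 b; rewrite le_eqVlt => /predU1P[<-|xb0]; first by rewrite mul0e.
  rewrite [lne (_ / _)%:E]lne_EFin ?share_gt0//.
  have [ab0|ab0] := ltP 0 (alpha b); first by rewrite [lne (alpha b)%:E]lne_EFin.
  by rewrite [lne (alpha b)%:E]le0_lneNy ?lee_fin//= gt0_muley ?lte_fin.
rewrite /entropy; apply/eqP; rewrite eqe_oppLR /=; apply/eqP.
have scaleNNy i (y : \bar R) : (y != -oo -> ((theta i)^-1)%:E * y != -oo)%E.
  case: y => [r| |]// _.
  by rewrite gt0_muley// lte_fin invr_gt0.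
apply/esum_eqyP => [i _|].
  apply: scaleNNy; rewrite esum_eqNy; apply/existsP => -[b /andP[/eqP bi]].
  by apply/negP; rewrite -bi.
exists (src a); split => //.
suff -> : (\sum_(b | src b == src a)
    (x 0 b)%:E * (lne (x 0 b / outflow x (src a))%:E - lne (alpha b)%:E) = +oo)%E.
  by rewrite gt0_muley// lte_fin invr_gt0.
apply/esum_eqyP => [b /eqP <-//|].
exists a; split => //.
rewrite [lne (_ / _)%:E]lne_EFin ?share_gt0//.
by rewrite [lne (alpha a)%:E]le0_lneNy ?lee_fin ?leNgt//= gt0_muley ?lte_fin.
Qed.

Lemma entropy_supported x : (forall a, 0 <= x 0 a) ->
  entropy P d x \is a fin_num <-> supported P d x.
Proof.
move=> x0; split=> [fin a xa0|/(entropyE x0) ->//].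
by apply: contraTT fin => na0; rewrite (entropyNy x0 xa0 na0).
Qed.

Definition xlnx (u : R) : R := u * ln u.

(** In this form the entropy depends on a single link flow through two terms:
    that of the link, and that of the outflow of its source. *)
Lemma rentropy_xlnx x : (forall a, 0 <= x 0 a) ->
  rentropy P d x = \sum_i (theta i)^-1 * xlnx (outflow x i)
    - \sum_a (theta (src a))^-1 * (xlnx (x 0 a) - x 0 a * ln (alpha a)).
Proof.
move=> x0; rewrite /rentropy.
have -> : \sum_i (theta i)^-1 * xlnx (outflow x i) =
    \sum_a (theta (src a))^-1 * (x 0 a * ln (outflow x (src a))).
  rewrite [RHS](partition_big (@src G) predT)//=; apply: eq_bigr => i _.
  rewrite /xlnx {1}/outflow mulr_suml mulr_sumr.
  by apply: eq_bigr => a /eqP ->.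
rewrite -sumrN -sumrB; apply: eq_bigr => a _.
have := x0 a; rewrite le_eqVlt => /predU1P[<-|xa0].
  by rewrite /xlnx !mul0r; ring.
by rewrite ln_div ?posrE ?outflow_gt0// /xlnx; ring.
Qed.

(** The right partial derivative along the link a is computed on the half-line
    [ray], where only the two terms of [rentropy_xlnx] vary. *)
Section Ray.
Variables (x : flow) (a : link G).
Hypothesis x_ge0 : forall b, 0 <= x 0 b.
Local Notation ray t := (x + t *: delta_mx 0 a : flow).
Local Notation X := (outflow x (src a)).

Lemma rayE t b : ray t 0 b = x 0 b + (if b == a then t else 0).
Proof. by rewrite !mxE eqxx /=; case: eqP; rewrite ?mulr1 ?mulr0. Qed.

Lemma ray_ge0 t b : 0 <= t -> 0 <= ray t 0 b.
Proof. by move=> t0; rewrite rayE addr_ge0//; case: ifP. Qed.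

Lemma outflow_ray t i :
  outflow (ray t) i = outflow x i + (if i == src a then t else 0).
Proof.
rewrite /outflow; under eq_bigr do rewrite rayE.
rewrite big_split /=; congr +%R; rewrite -big_mkcondr /=.
have [->|ia] := eqVneq i (src a).
  rewrite (big_pred1 a)// => b /=; apply/andP/eqP => [[_ /eqP//]|->].
  by rewrite !eqxx.
by rewrite big_pred0// => b; case: (eqVneq b a) => [->|]; rewrite ?andbF//
  andbT eq_sym (negbTE ia).
Qed.

Lemma ray_supported t : 0 < alpha a -> supported P d x -> supported P d (ray t).
Proof.
move=> a0 supp b; rewrite rayE; case: eqP => [-> //|_].
by rewrite addr0; exact: supp.
Qed.

Definition xlnx_slope (u t : R) := t^-1 * (xlnx (u + t) - xlnx u).

Lemma rentropy_ray t : 0 < t ->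
  t^-1 * (rentropy P d (ray t) - rentropy P d x) =
  (theta (src a))^-1 *
    (xlnx_slope X t - xlnx_slope (x 0 a) t + ln (alpha a)).
Proof.
move=> t0; rewrite !rentropy_xlnx//; last by move=> b; rewrite ray_ge0 ?ltW.
have -> : \sum_i (theta i)^-1 * xlnx (outflow (ray t) i) =
    \sum_i (theta i)^-1 * xlnx (outflow x i) +
    (theta (src a))^-1 * (xlnx (X + t) - xlnx X).
  rewrite (bigD1 (src a))//= [in RHS](bigD1 (src a))//= outflow_ray eqxx.
  rewrite (eq_bigr (fun i => (theta i)^-1 * xlnx (outflow x i))); last first.
    by move=> i /negbTE ia; rewrite outflow_ray ia addr0.
  ring.
have -> : \sum_b (theta (src b))^-1 *
      (xlnx (ray t 0 b) - ray t 0 b * ln (alpha b)) =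
    \sum_b (theta (src b))^-1 * (xlnx (x 0 b) - x 0 b * ln (alpha b)) +
    (theta (src a))^-1 * (xlnx (x 0 a + t) - xlnx (x 0 a) - t * ln (alpha a)).
  rewrite (bigD1 a)//= [in RHS](bigD1 a)//= rayE eqxx.
  rewrite (eq_bigr (fun b => (theta (src b))^-1 *
      (xlnx (x 0 b) - x 0 b * ln (alpha b)))); last first.
    by move=> b /negbTE ba; rewrite rayE ba addr0.
  ring.
rewrite /xlnx_slope; field.
by rewrite !gt_eqF.
Qed.

Lemma quotient_ray t : 0 < t -> 0 < alpha a -> supported P d x ->
  ((t^-1)%:E * (entropy P d (ray t) - entropy P d x))%E =
  ((theta (src a))^-1 *
    (xlnx_slope X t - xlnx_slope (x 0 a) t + ln (alpha a)))%:E.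
Proof.
move=> t0 a0 supp; rewrite !entropyE//; last 2 first.
- by move=> b; rewrite ray_ge0 ?ltW.
- exact: ray_supported.
by rewrite -EFinB -EFinM rentropy_ray.
Qed.

Lemma xlnx_slope0 t : 0 < t -> xlnx_slope 0 t = ln t.
Proof. by move=> t0; rewrite /xlnx_slope /xlnx add0r mul0r subr0 mulKf ?gt_eqF. Qed.

Lemma xlnx_slope_cvg (u : R) : 0 < u -> xlnx_slope u t @[t --> 0^'+] --> ln u + 1.
Proof.
move=> u0; apply: cvg_dnbhs_at_right.
have du : is_derive u 1 xlnx (u *: u^-1 + ln u *: 1).
  have dln := is_derive1_ln u0.
  exact: (is_deriveM (f := id) (g := @ln R)).
have -> : ln u + 1 = 'D_1 xlnx u.
  by rewrite derive_val scaler1 /GRing.scale /= divff ?gt_eqF// addrC.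
have dv : derivable xlnx u 1 by exact: ex_derive.
apply: cvg_trans dv; apply: near_eq_cvg; apply: nearW => t /=.
by rewrite /xlnx_slope /GRing.scale /= mulr1 [u + t]addrC.
Qed.

Lemma grad_entropy_unallocated : ~~ (0 < alpha a) -> supported P d x ->
  grad_entropy P d x a = -oo%E.
Proof.
move=> na0 supp; apply: lim_near_cst; first exact: ereal_hausdorff.
near=> t.
have t0 : 0 < t by near: t; exact: nbhs_right_gt.
rewrite (@entropyNy _ a) ?entropyE//=.
- by rewrite gt0_muleNy// lte_fin invr_gt0.
- by move=> b; rewrite ray_ge0 ?ltW.
- by rewrite rayE eqxx ltr_wpDl.
Unshelve. all: by end_near. Qed.

Lemma grad_entropy_pos : 0 < x 0 a -> supported P d x ->
  grad_entropy P d x a =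
  (- ((theta (src a))^-1 * (ln (x 0 a / X) - ln (alpha a))))%:E.
Proof.
move=> xa0 supp; have X0 := outflow_gt0 x_ge0 xa0.
apply: cvg_lim; first exact: ereal_hausdorff.
have -> : (- ((theta (src a))^-1 * (ln (x 0 a / X) - ln (alpha a)))) =
    (theta (src a))^-1 * ((ln X + 1) - (ln (x 0 a) + 1) + ln (alpha a)).
  by rewrite ln_div ?posrE//; ring.
apply: (@cvg_trans _ ((((theta (src a))^-1 *
    (xlnx_slope X t - xlnx_slope (x 0 a) t + ln (alpha a)))%:E) @[t --> 0^'+])).
  apply: near_eq_cvg; near=> t; rewrite quotient_ray ?supp//.
apply: cvg_EFin; first exact: nearW.
apply: cvgMl_tmp; apply: cvgD; last exact: cvg_cst.
by apply: cvgB; exact: xlnx_slope_cvg.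
Unshelve. all: by end_near. Qed.

(** At a node without flow the slopes of the link term and of the outflow term
    cancel, so the difference quotient is constant. *)
Lemma grad_entropy_empty : 0 < alpha a -> X = 0 -> supported P d x ->
  grad_entropy P d x a = ((theta (src a))^-1 * ln (alpha a))%:E.
Proof.
move=> a0 X0 supp; apply: lim_near_cst; first exact: ereal_hausdorff.
near=> t.
have xa0 : x 0 a = 0.
  by apply/eqP; rewrite eq_le x_ge0 andbT -X0 le_outflow.
by rewrite quotient_ray// X0 xa0 subrr add0r.
Unshelve. all: by end_near. Qed.

(** The link term has slope ln t, which tends to -oo, and the outflow term a
    finite slope. *)
Lemma grad_entropy_boundary : 0 < alpha a -> x 0 a = 0 -> 0 < X ->
  supported P d x -> grad_entropy P d x a = +oo%E.
Proof.
move=> a0 xa0 X0 supp; apply: cvg_lim; first exact: ereal_hausdorff.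
apply: (@cvg_trans _ ((((theta (src a))^-1 *
    (xlnx_slope X t - ln t + ln (alpha a)))%:E) @[t --> 0^'+])).
  apply: near_eq_cvg; near=> t.
  have t0 : 0 < t by near: t; exact: nbhs_right_gt.
  by rewrite quotient_ray// xa0 xlnx_slope0.
apply/cvgeryP/cvgryPge => A; near=> t.
rewrite ler_pdivlMl//.
have sl : ln X <= xlnx_slope X t.
  near: t; have /cvgrPdist_lt/(_ 1 ltr01) := xlnx_slope_cvg X0.
  apply: filterS => t; rewrite ltr_norml => /andP[_]; lra.
have lnt : ln t <= ln X + ln (alpha a) - theta (src a) * A.
  by near: t; move: (@lnNy R) => /cvgrNyPle; apply.
lra.
Unshelve. all: by end_near. Qed.

End Ray.

End Entropy.

(** * Link costs in terms of queue loads *)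

Section Supply.
Variables (R : realType) (G : network) (K : cost_data R G).
Local Notation flow := 'rV[R]_(nlinks G).
Implicit Types (x y v : flow) (a : link G) (rs : rs_pair G) (l : 'I_(nqueue G)).

Local Notation cap rs := (capacity K (val rs).1).

Lemma pick_queue rs l :
  [pick p : rs_pair G * 'I_(nqueue G) | qlink p.1 p.2 == qlink rs l] = Some (rs, l).
Proof.
case: pickP => [[rs' l'] /eqP/= /qlink_inj[-> -> //]|/(_ (rs, l))].
by rewrite eqxx.
Qed.

Lemma pick_own a : kind a <> Queue ->
  [pick p : rs_pair G * 'I_(nqueue G) | qlink p.1 p.2 == a] = None.
Proof.
move=> na; case: pickP => // -[rs l] /eqP/= ea.
by case: na; apply/queueP; exists rs, l.
Qed.

Lemma link_case a : (exists rs l, a = qlink rs l) \/ kind a <> Queue.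
Proof. by case ka : (kind a); [right..|left; apply/queueP]. Qed.

Lemma entry_own rs : kind (obl rs ord0) <> Queue.
Proof. by case: (entry_kind rs) => ->. Qed.

Lemma link_cost_queue x rs l : link_cost K x (qlink rs l) =
  if queue_load x rs l < cap rs
  then (queue_cost K l (cap rs) (queue_load x rs l))%:E else +oo%E.
Proof. by rewrite /link_cost pick_queue. Qed.

Lemma link_cost_own x a : kind a <> Queue ->
  link_cost K x a = (own_cost K a (x 0 a))%:E.
Proof. by move=> na; rewrite /link_cost pick_own. Qed.

Lemma supply_feasibleP x : supply_feasible K x <->
  (forall a, 0 <= x 0 a) /\ forall rs l, queue_load x rs l < cap rs.
Proof.
split=> -[x0 fin]; split=> //.
  by move=> rs l; have := fin (qlink rs l); rewrite link_cost_queue; case: ifP.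
move=> a; have [[rs [l ->]]|na] := link_case a.
  by rewrite link_cost_queue fin.
by rewrite link_cost_own.
Qed.

(** The cost of each link is an increasing function of its load alone, and the
    loads are coordinates on the space of flows: the flow of a queue link is
    its load minus that of the preceding link, which for the first one is the
    link of the run entering the on-board sequence. *)
Definition load x a : R :=
  if [pick p : rs_pair G * 'I_(nqueue G) | qlink p.1 p.2 == a] is Some p
  then queue_load x p.1 p.2 else x 0 a.

Lemma load_queue x rs l : load x (qlink rs l) = queue_load x rs l.
Proof. by rewrite /load pick_queue. Qed.

Lemma load_own x a : kind a <> Queue -> load x a = x 0 a.
Proof. by move=> na; rewrite /load pick_own. Qed.

Definition prev_link rs l : link G :=
  if l == 0 :> nat then obl rs ord0
  else qlink rs (Ordinal (leq_ltn_trans (leq_pred l) (ltn_ord l))).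

Lemma load_prev x rs l :
  load x (qlink rs l) = load x (prev_link rs l) + x 0 (qlink rs l).
Proof.
rewrite load_queue /prev_link /queue_load (bigD1 l)//= [X in _ + X]addrC addrA.
congr +%R; case: (eqVneq (l : nat) 0%N) => [l0|l0].
  rewrite load_own; last exact: entry_own.
  rewrite big_pred0 ?addr0// => k; rewrite -val_eqE /= l0 leqn0.
  by case: eqP.
rewrite load_queue /queue_load; congr +%R; apply: eq_bigl => k /=.
rewrite -val_eqE /= andbC -ltn_neqAle.
by case: (nat_of_ord l) l0.
Qed.

(** Induction along the queue sequences, from the links that are not queues. *)
Lemma queue_ind (Q : link G -> Prop) :
  (forall a, kind a <> Queue -> Q a) ->
  (forall rs l, Q (prev_link rs l) -> Q (qlink rs l)) -> forall a, Q a.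
Proof.
move=> Qown Qqueue a; have [[rs [l ->]]|] := link_case a; last exact: Qown.
case: l => l; elim: l => [|l IH] ltl; apply: Qqueue.
  exact/Qown/entry_own.
rewrite /prev_link /=; set k := Ordinal _.
by have -> : k = Ordinal (ltnW ltl) by exact: val_inj.
Qed.

Lemma load_inj x y : load x =1 load y -> x = y.
Proof.
move=> xy; apply/rowP => a; have [[rs [l ->]]|na] := link_case a.
  by have := xy (qlink rs l); rewrite !load_prev xy => /addrI.
by rewrite -!load_own.
Qed.

Definition of_load (U : link G -> R) : flow :=
  \row_a if [pick p : rs_pair G * 'I_(nqueue G) | qlink p.1 p.2 == a] is Some p
         then U a - U (prev_link p.1 p.2) else U a.

Lemma of_load_queue U rs l :
  of_load U 0 (qlink rs l) = U (qlink rs l) - U (prev_link rs l).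
Proof. by rewrite mxE pick_queue. Qed.

Lemma of_load_own U a : kind a <> Queue -> of_load U 0 a = U a.
Proof. by move=> na; rewrite mxE pick_own. Qed.

Lemma of_loadK U : load (of_load U) =1 U.
Proof.
apply: queue_ind => [a na|rs l IH]; first by rewrite load_own// of_load_own.
by rewrite load_prev IH of_load_queue addrCA subrr addr0.
Qed.

Lemma load_ge0 x a : (forall b, 0 <= x 0 b) -> 0 <= load x a.
Proof.
move=> x0; elim/queue_ind: a => [a /load_own ->//|rs l IH].
by rewrite load_prev addr_ge0.
Qed.

Lemma queue_loadD x v t rs l :
  queue_load (x + t *: v) rs l = queue_load x rs l + t * queue_load v rs l.
Proof.
rewrite /queue_load !mxE; under eq_bigr do rewrite !mxE.
rewrite big_split /= -mulr_sumr; ring.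
Qed.

Lemma cost_own x a : kind a <> Queue -> cost K x 0 a = own_cost K a (load x a).
Proof. by move=> na; rewrite mxE link_cost_own// load_own. Qed.

Lemma cost_queue x rs l : supply_feasible K x ->
  cost K x 0 (qlink rs l) = queue_cost K l (cap rs) (load x (qlink rs l)).
Proof.
by move=> /supply_feasibleP[_ xcap]; rewrite mxE link_cost_queue xcap load_queue.
Qed.

Lemma cost_load_lt x y a : supply_feasible K x -> supply_feasible K y ->
  load x a < load y a -> cost K x 0 a < cost K y 0 a.
Proof.
move=> xY yY lxy.
have [[x0 xcap] [y0 ycap]] := (proj1 (supply_feasibleP x) xY,
  proj1 (supply_feasibleP y) yY).
have [[rs [l al]]|na] := link_case a; last first.
  rewrite !cost_own//; apply: own_cost_incr => //;
    by rewrite in_itv/= andbT load_ge0.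
rewrite al in lxy *; rewrite !cost_queue//.
apply: queue_cost_incr => //; first exact: capacity_gt0.
  by rewrite in_itv/= load_ge0// load_queue xcap.
by rewrite in_itv/= load_ge0// load_queue ycap.
Qed.

Lemma cost_load_eq x y a : supply_feasible K x -> supply_feasible K y ->
  load x a = load y a -> cost K x 0 a = cost K y 0 a.
Proof.
move=> xY yY; have [[rs [l ->]]|na] := link_case a.
  by rewrite !cost_queue// => ->.
by rewrite !cost_own// => ->.
Qed.

Lemma cost_inj : {in supply_feasible K &, injective (cost K)}.
Proof.
move=> x y /set_mem xY /set_mem yY xy; apply: load_inj => a.
have [lt|lt|//] := ltgtP (load x a) (load y a).
  by have := cost_load_lt xY yY lt; rewrite xy ltxx.
by have := cost_load_lt yY xY lt; rewrite xy ltxx.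
Qed.

Lemma costK x : supply_feasible K x -> cost_inv K (cost K x) = x.
Proof.
move=> xY; rewrite /cost_inv. apply: pinvKV; last exact/mem_set.
exact: cost_inj.
Qed.

(** Capacity constraints are strict, so they survive a small move in any
    direction. *)
Lemma capacity_near x v : supply_feasible K x ->
  \forall t \near (0 : R)^'+, forall rs l, queue_load (x + t *: v) rs l < cap rs.
Proof.
move=> /supply_feasibleP[_ xcap].
have : \forall t \near (0 : R)^'+, forall p : rs_pair G * 'I_(nqueue G),
    queue_load (x + t *: v) p.1 p.2 < cap p.1.
  apply: filter_forall => -[rs l] /=.
  have gap : 0 < cap rs - queue_load x rs l by rewrite subr_gt0.
  near=> t.
  have t0 : 0 < t by near: t; exact: nbhs_right_gt.
  rewrite queue_loadD.
  have tsmall : t < (cap rs - queue_load x rs l) / (`|queue_load v rs l| + 1).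
    by near: t; apply: nbhs_right_lt; rewrite divr_gt0// ltr_wpDl.
  have : t * queue_load v rs l <= t * `|queue_load v rs l|.
    by rewrite ler_pM2l// ler_norm.
  move: tsmall; rewrite ltr_pdivlMr; last by rewrite ltr_wpDl.
  rewrite mulrDr mulr1; lra.
by apply: filterS => t + rs l => /(_ (rs, l)).
Unshelve. all: by end_near. Qed.

End Supply.

(** * The variational inequality in flows *)

Section DemandVI.
Variables (R : realType) (G : network) (K : cost_data R G).
Variables (M : demand_data R G) (P : ngev_data M).
Local Notation flow := 'rV[R]_(nlinks G).

Section Destination.
Variable d : node G.
Hypothesis dD : d \in dests M.
Local Notation theta := (scale P d).
Implicit Types (c x y : flow) (a : link G).

Let theta_gt0 i : 0 < theta i. Proof. exact: scale_gt0. Qed.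

Lemma Xd_outflow x i : Xd M d x -> i != d ->
  outflow x i = demand M d i + inflow x i.
Proof. by move=> [_ xcons] /xcons <-; rewrite subrK. Qed.

(** A node with flow y is an origin or receives y from a node upstream, so the
    hypothesis propagates the positivity of x from the origins downstream. *)
Lemma flow_domination x y : Xd M d x -> Xd M d y ->
  (forall a, 0 < y 0 a -> 0 < outflow x (src a) -> 0 < x 0 a) ->
  forall a, 0 < y 0 a -> 0 < x 0 a.
Proof.
move=> xX yX dom.
suff nodes i : i != d -> 0 < outflow y i -> 0 < outflow x i.
  move=> a ya0; apply: dom => //; apply: nodes; last exact: outflow_gt0 yX.1 ya0.
  by apply: contraTneq ya0 => /(Xd_dest_out dD yX) ->; rewrite ltxx.
elim/upward_ind: i => i IH id.
rewrite (Xd_outflow yX id) (Xd_outflow xX id) => out0.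
have in0 : 0 <= inflow x i by apply: sumr_ge0 => a _; exact: xX.1.
have := demand_ge0 dD i; rewrite le_eqVlt => /predU1P[dem0|dem0]; last first.
  by rewrite ltr_pwDl.
move: out0; rewrite -dem0 !add0r lt0r => /andP[/eqP inN0 _].
have [a /andP[/eqP ai ya0]] : exists a, (tgt a == i) && (0 < y 0 a).
  by apply: psumr_neq0P inN0 => b _; exact: yX.1.
rewrite -ai; apply: lt_le_trans (le_inflow a xX.1); apply: dom => //.
apply: IH => //; last exact: outflow_gt0 yX.1 ya0.
by apply: contraTneq ya0 => /(Xd_dest_out dD yX) ->; rewrite ltxx.
Qed.

(** The loading uses every link that some flow of finite entropy can use. *)
Lemma ngev_flow_dominates c x a : Xd M d x -> supported P d x ->
  0 < x 0 a -> 0 < ngev_flow P d c 0 a.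
Proof.
move=> xX supp; have srv := supported_served dD xX supp.
apply: (flow_domination (ngev_flow_Xd dD c srv) xX) => b xb0 out0.
 rewrite ngev_flow_prob//; apply: mulr_gt0 => //.
exact/prob_gt0/(supported_usable dD xX).
Qed.

(** The divergence with the two distributions exchanged. *)
Lemma reverse_divergence_ge0 c x : Xd M d x -> served P d ->
  (forall a, 0 < ngev_flow P d c 0 a -> 0 < x 0 a) ->
  0 <= \sum_a (theta (src a))^-1 * (ngev_flow P d c 0 a *
         (ln (prob P d c a) - ln (x 0 a / outflow x (src a)))).
Proof.
move=> xX srv dom; set y := ngev_flow P d c.
rewrite (partition_big (@src G) predT)//=; apply: sumr_ge0 => i _.
rewrite (eq_bigr (fun a => (theta i)^-1 *
  (y 0 a * (ln (y 0 a / outflow y i) - ln (x 0 a / outflow x i))))); last first.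
  move=> a /eqP <-; congr (_ * _).
  have share0 : y 0 a * (ln (y 0 a / outflow y (src a)) - ln (prob P d c a)) = 0.
    apply: share_prob; first exact: ngev_flow_Xd.
    by move=> b; exact: ngev_flow_prob.
  by rewrite -[LHS]addr0 -share0; ring.
rewrite -mulr_sumr; apply: mulr_ge0; first by rewrite invr_ge0 ltW.
have out_ge0 j : 0 <= outflow x j by apply: sumr_ge0 => a _; exact: xX.1.
have [out0|/negP out0] := boolP (0 < outflow x i).
  apply: gibbs_ge0 => [a _|a _|a /eqP ai ya0|].
  - exact: ngev_flow_ge0.
  - by rewrite divr_ge0 ?xX.1.
  - by rewrite divr_gt0 ?dom.
  - by rewrite -mulr_suml divff ?gt_eqF.
rewrite big1// => a /eqP ai; suff -> : y 0 a = 0 by rewrite mul0r.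
apply/eqP; rewrite eq_le ngev_flow_ge0// andbT leNgt; apply/negP => ya0.
by apply: out0; rewrite -ai (outflow_gt0 xX.1)// dom.
Qed.

End Destination.

Import DualAddTheory.

(** In the dual addition, +oo absorbs -oo. *)
Lemma dual_sum_ge0 (I : finType) (A : pred I) (f : I -> \bar R) :
  (forall i, A i -> f i != +oo%E) -> (0 <= \sum_(i | A i) f i)%dE ->
  (forall i, A i -> f i \is a fin_num) /\ 0 <= \sum_(i | A i) fine (f i).
Proof.
move=> fNy f0.
have ffin i : A i -> f i \is a fin_num.
  move=> Ai; rewrite fin_numE fNy// andbT; apply/eqP => fi.
  suff sumNy : (\sum_(i | A i) f i)%dE = -oo%E by move: f0; rewrite sumNy.
  by apply/desum_eqNyP => //; exists i; split.
split=> //; rewrite -lee_fin -dsumEFin.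
by rewrite (eq_bigr f)// => i Ai; rewrite fineK// ffin.
Qed.

Lemma aggregate_ge0 xh a : Xhat M xh -> 0 <= aggregate M xh 0 a.
Proof.
move=> xhX; rewrite /aggregate summxE; apply: sumr_ge0 => d dD.
exact: (xhX d dD).1.
Qed.

Definition update (xh : node G -> flow) d (x : flow) : node G -> flow :=
  fun e => if e == d then x else xh e.

Lemma aggregate_update xh d x : d \in dests M ->
  aggregate M (update xh d x) = aggregate M xh + (x - xh d).
Proof.
move=> dD; rewrite /aggregate (bigD1 d)//= [in RHS](bigD1 d)//= /update eqxx.
rewrite (eq_bigr xh); last by move=> e /andP[_ /negbTE ->].
by rewrite [RHS]addrC addrA subrK.
Qed.

Lemma Xd_segment d x y t : 0 <= t <= 1 -> Xd M d x -> Xd M d y ->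
  Xd M d (x + t *: (y - x)).
Proof.
move=> /andP[t0 t1] [x0 xcons] [y0 ycons]; split=> [a|i id].
  rewrite !mxE [X in 0 <= X](_ : _ = (1 - t) * x 0 a + t * y 0 a); last by ring.
  by rewrite addr_ge0// mulr_ge0// subr_ge0.
have lin (A : pred (link G)) : \sum_(a | A a) (x + t *: (y - x)) 0 a =
    (1 - t) * (\sum_(a | A a) x 0 a) + t * \sum_(a | A a) y 0 a.
  rewrite !mulr_sumr -big_split; apply: eq_bigr => a _; rewrite !mxE/=; ring.
rewrite /outflow /inflow !lin.
transitivity ((1 - t) * (outflow x i - inflow x i) +
  t * (outflow y i - inflow y i)); first by rewrite /outflow /inflow; ring.
by rewrite xcons// ycons//; ring.
Qed.

(** The test flow moves x a little towards the loading y at the current costs.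
    If y used a link on which x vanishes, then at the first such link the
    gradient would be +oo and the sum -oo. So x is positive wherever y is; all
    terms are finite, the potentials telescope, and the sum is minus the
    relative entropies of x and y with respect to each other. Both vanish. *)
Lemma VI_D_ngev xh d : VI_D K P xh -> d \in dests M ->
  xh d = ngev_flow P d (cost K (aggregate M xh)).
Proof.
move=> [[xhX [_ xhY]] entfin VI] dD.
set c := cost K _; set x := xh d; set y := ngev_flow P d c.
have xX : Xd M d x := xhX d dD.
have supp : supported P d x by apply: (proj1 (entropy_supported P dD xX.1)); exact: entfin.
have srv := supported_served dD xX supp.
have yX : Xd M d y by exact: ngev_flow_Xd.
have [t [t0 t1 tY]] : exists t, [/\ 0 < t, t <= 1 &
    supply_feasible K (aggregate M (update xh d (x + t *: (y - x))))].
  near (0 : R)^'+ => t; exists t; split.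
  - by near: t; exact: nbhs_right_gt.
  - by near: t; exact: nbhs_right_ltW.
  have t0 : 0 < t by near: t; exact: nbhs_right_gt.
  have t1 : t <= 1 by near: t; exact: nbhs_right_ltW.
  apply/supply_feasibleP; split=> [a|].
    apply: aggregate_ge0 => e eD; rewrite /update; case: eqP => [->|_].
      by apply: Xd_segment => //; rewrite ltW.
    exact: xhX.
  rewrite aggregate_update// [x + _]addrC addrK.
  by near: t; exact: capacity_near.
have xtX : Xhat M (update xh d (x + t *: (y - x))).
  move=> e eD; rewrite /update; case: eqP => [->|_]; last exact: xhX.
  by apply: Xd_segment => //; rewrite ltW.
have := VI _ xtX (conj (ex_intro2 _ _ _ xtX erefl) tY).
rewrite (bigD1 d)//= [X in (_ + X)%dE]big1 ?dadde0; last first.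
  move=> e /andP[_ /negbTE ed]; apply: big1 => a _.
  by rewrite /update ed subrr mule0.
rewrite /update eqxx -/x.
under eq_bigr => a _.
  rewrite (_ : (x + t *: (y - x)) 0 a - x 0 a = t * (y 0 a - x 0 a)); last first.
    by rewrite !mxE; ring.
  over.
pose f a := ((link_cost K (aggregate M xh) a - grad_entropy P d x a) *
  (t * (y 0 a - x 0 a))%:E)%E.
have zero_of_unallocated (z : flow) a : Xd M d z -> supported P d z ->
    ~~ (0 < allocation P d a) -> z 0 a = 0.
  move=> [z0 _] zsupp na0; apply/eqP; rewrite eq_le z0 andbT leNgt.
  by apply: contra na0 => /zsupp.
have ysupp : supported P d y by exact: ngev_flow_supported.
have fpos a : 0 < x 0 a -> f a = ((c 0 a + (scale P d (src a))^-1 *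
    (ln (x 0 a / outflow x (src a)) - ln (allocation P d a))) *
    (t * (y 0 a - x 0 a)))%:E.
  move=> xa0; rewrite /f -link_cost_cost// grad_entropy_pos//; last exact: xX.1.
  by rewrite -EFinB opprK -EFinM.
have fNy_of_boundary a : 0 < allocation P d a -> x 0 a = 0 ->
    0 < outflow x (src a) -> 0 < y 0 a -> f a = -oo%E.
  move=> a0 xa0 out0 ya0; rewrite /f -link_cost_cost//.
  rewrite grad_entropy_boundary//; last exact: xX.1.
  by rewrite xa0 subr0 /= gt0_mulNye// lte_fin mulr_gt0.
have out_ge0 i : 0 <= outflow x i by apply: sumr_ge0 => a _; exact: xX.1.
have fNy a : f a != +oo%E.
  have [a0|na0] := boolP (0 < allocation P d a); last first.
    by rewrite /f !zero_of_unallocated// subrr mulr0 mule0.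
  have := xX.1 a; rewrite le_eqVlt => /predU1P[/esym xa0|/fpos -> //].
  have := out_ge0 (src a); rewrite le_eqVlt => /predU1P[/esym out0|out0].
    by rewrite /f -link_cost_cost// grad_entropy_empty//; exact: xX.1.
  have := yX.1 a; rewrite le_eqVlt => /predU1P[ya0|ya0].
    by rewrite /f xa0 -ya0 subr0 mulr0 mule0.
  by rewrite fNy_of_boundary.
move=> /(dual_sum_ge0 (fun a _ => fNy a))[ffin fsum].
have dom : forall a, 0 < y 0 a -> 0 < x 0 a.
  apply: (flow_domination dD xX yX) => a ya0 out0.
  rewrite lt0r xX.1 andbT; apply/eqP => xa0.
  by have := ffin a isT; rewrite fNy_of_boundary// ysupp.
pose lnratio a := ln (x 0 a / outflow x (src a)) - ln (prob P d c a).
have fE a : fine (f a) = t * (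
    (emc P d c (src a) - emc P d c (tgt a)) * (y 0 a - x 0 a)
    + (scale P d (src a))^-1 * (y 0 a * lnratio a)
    - (scale P d (src a))^-1 * (x 0 a * lnratio a)).
  have := xX.1 a; rewrite le_eqVlt => /predU1P[xa0|xa0].
    have ya0 : y 0 a = 0.
      by apply/eqP; rewrite eq_le yX.1 andbT leNgt; apply/negP => /dom; rewrite -xa0 ltxx.
    by rewrite /f ya0 -xa0 subrr !mulr0 mule0 /= !mul0r !mulr0 addr0 subr0 mulr0.
  rewrite fpos//= (cost_emc dD c (supported_usable dD xX supp xa0)) /lnratio; ring.
have xdiv0 : divergence P d c x = 0.
  apply/eqP; rewrite eq_le divergence_ge0// andbT.
  move: fsum; under eq_bigr do rewrite fE.
  rewrite -mulr_sumr pmulr_rge0// sumrB big_split /=.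
  under eq_bigr do rewrite mulrBr !(mulrC (_ - _)).
  rewrite sumrB (circulation_Xd yX (emc_dest P d c)).
  rewrite (circulation_Xd xX (emc_dest P d c)).
  rewrite subrr add0r subr_ge0 => /le_trans; apply.
  have := reverse_divergence_ge0 dD xX srv dom.
  rewrite -oppr_le0 -sumrN; apply: le_trans; apply: ler_sum => a _.
  by rewrite /lnratio -/y -mulrN -mulrN opprB.
apply: (ngev_flow_unique xX).
exact: divergence_eq0.
Unshelve. all: by end_near. Qed.

(** At a loading, costs minus gradient are differences of the potential
    [emc], which vanish along the difference of two flows with the same demand,
    unless the test flow uses a link of allocation 0, which costs +oo. *)
Lemma ngev_VI_D xh : Xhat M xh -> supply_feasible K (aggregate M xh) ->
  (forall d, d \in dests M ->
     xh d = ngev_flow P d (cost K (aggregate M xh))) ->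
  VI_D K P xh.
Proof.
move=> xhX xhY; set c := cost K _ => xhE.
have supp d : d \in dests M -> supported P d (xh d).
  by move=> dD; rewrite xhE//; exact: ngev_flow_supported.
split; first by split=> //; split=> //; exists xh.
  by move=> d dD; apply/(entropy_supported P dD (xhX d dD).1)/supp.
move=> z zX [_ zY].
have [[d [a [dD za0 na0]]]|zsupp] : (exists d a, [/\ d \in dests M, 0 < z d 0 a &
    ~~ (0 < allocation P d a)]) \/ (forall d, d \in dests M -> supported P d (z d)).
  have [|nex] := pselect (exists d a, [/\ d \in dests M, 0 < z d 0 a &
    ~~ (0 < allocation P d a)]); [by left|right=> d dD a za0].
  by apply/negPn/negP => na0; apply: nex; exists d, a; split.
  rewrite [X in (_ <= X)%E](_ : _ = +oo%E) ?leey//.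
  apply/desum_eqyP; exists d; split=> //.
  apply/desum_eqyP; exists a; split=> //.
  have xa0 : xh d 0 a = 0.
    apply/eqP; rewrite eq_le (xhX d dD).1 andbT leNgt.
    by apply: contra na0 => /(supp d dD).
  rewrite grad_entropy_unallocated//; last 2 first.
  - exact: (xhX d dD).1.
  - exact: supp.
  by rewrite xa0 subr0 -link_cost_cost//= gt0_mulye// lte_fin.
have termE d a : d \in dests M ->
    ((link_cost K (aggregate M xh) a - grad_entropy P d (xh d) a) *
     (z d 0 a - xh d 0 a)%:E)%E =
    (z d 0 a * (emc P d c (src a) - emc P d c (tgt a)) -
     xh d 0 a * (emc P d c (src a) - emc P d c (tgt a)))%:E.
  move=> dD; have xX := xhX d dD.
  have := xX.1 a; rewrite le_eqVlt => /predU1P[xa0|xa0].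
    have za0 : z d 0 a = 0.
      apply/eqP; rewrite eq_le (zX d dD).1 andbT leNgt; apply/negP.
      move=> /(ngev_flow_dominates dD c (zX d dD) (zsupp d dD)).
      by rewrite -xhE// -xa0 ltxx.
    by rewrite za0 -xa0 subrr mule0 !mul0r subrr.
  have ua := supported_usable dD xX (supp d dD) xa0.
  rewrite grad_entropy_pos//; last 2 first.
  - exact: xX.1.
  - exact: supp.
  rewrite -link_cost_cost// -EFinB -EFinM; congr EFin.
  have srv := supported_served dD xX (supp d dD).
  have -> : xh d 0 a / outflow (xh d) (src a) = prob P d c a.
    rewrite xhE// ngev_flow_prob// -xhE// mulfK// gt_eqF//.
    exact: outflow_gt0 xX.1 xa0.
  rewrite -/c (cost_emc dD c ua); ring.
rewrite big1// => d dD; under eq_bigr do rewrite termE//.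
rewrite dsumEFin sumrB (circulation_Xd (zX d dD) (emc_dest P d c)).
by rewrite (circulation_Xd (xhX d dD) (emc_dest P d c)) subrr.
Qed.

End DemandVI.
(** * The perceived minimum cost and its gradient *)

Section Conjugate.
Variables (R : realType) (G : network) (M : demand_data R G) (P : ngev_data M).
Variable d : node G.
Hypothesis dD : d \in dests M.
Local Notation flow := 'rV[R]_(nlinks G).
Implicit Types (c x y h : flow) (i : node G) (a : link G).

(** A finite value requires a flow of finite entropy. *)
Lemma Hstar_served c : Hstar P d c \is a fin_num -> served P d.
Proof.
move=> fin; have : (Hstar P d c < +oo)%E by rewrite ltey_eq fin.
move=> /ereal_inf_lt[_ [x xX <-]] lty.
apply: (supported_served dD xX) => a xa0.
apply: contraTT lty => na0.
by rewrite (entropyNy dD xX.1 xa0 na0) -leNgt.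
Qed.

(** Continuity of the loading in the link costs, by induction over the network,
    along a filter that makes each link cost converge. *)
Section Convergence.
Context (F : set_system flow) {FF : Filter F} (c : flow).
Hypothesis Fc : forall a, c' 0 a @[c' --> F] --> c 0 a.

Lemma weight_cvg a :
  (emc P d c' (tgt a) @[c' --> F] --> emc P d c (tgt a)) ->
  weight P d c' (emc P d c') a @[c' --> F] --> weight P d c (emc P d c) a.
Proof.
rewrite /weight; case: (usable P d a) => cvg_tgt; last exact: cvg_cst.
apply: cvgMl_tmp; apply: continuous_cvg; first exact: continuous_expR.
by apply: cvgN; apply: cvgMl_tmp; apply: cvgD; [exact: Fc|exact: cvg_tgt].
Qed.

Lemma emc_cvg i : emc P d c' i @[c' --> F] --> emc P d c i.
Proof.
elim/downward_ind: i => i IH.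
have [/andP[ri id]|nri] := boolP (reaches P d i && (i != d)); last first.
  rewrite emc0//; under eq_cvg do rewrite emc0//; exact: cvg_cst.
rewrite emcE; under eq_cvg do rewrite emcE.
apply: cvgN; apply: cvgMl_tmp; apply: continuous_cvg.
  by apply: continuous_ln; exact: total_weight_gt0.
apply: cvg_big => [|a /eqP ai]; first exact: add_continuous.
by apply: weight_cvg; exact: IH.
Qed.

Lemma prob_cvg a : prob P d c' a @[c' --> F] --> prob P d c a.
Proof.
have [ua|nua] := boolP (usable P d a); last first.
  rewrite prob0//; under eq_cvg do rewrite prob0//; exact: cvg_cst.
apply: cvgM; first by apply: weight_cvg; exact: emc_cvg.
apply: cvgV; first by rewrite gt_eqF// total_weight_usable.
apply: cvg_big => [|b _]; first exact: add_continuous.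
by apply: weight_cvg; exact: emc_cvg.
Qed.

Lemma node_flow_cvg i : node_flow P d c' i @[c' --> F] --> node_flow P d c i.
Proof.
elim/upward_ind: i => i IH.
rewrite node_flowE; under eq_cvg do rewrite node_flowE.
apply: cvgD; first exact: cvg_cst.
apply: cvg_big => [|a /eqP ai]; first exact: add_continuous.
by apply: cvgM; [exact: prob_cvg|exact: IH].
Qed.

Lemma ngev_flow_cvg a : ngev_flow P d c' 0 a @[c' --> F] --> ngev_flow P d c 0 a.
Proof.
have flowE : (fun c' => prob P d c' a * node_flow P d c' (src a)) =
    (fun c' => ngev_flow P d c' 0 a).
  by apply/funext => c'; rewrite mxE.
have limE : prob P d c a * node_flow P d c (src a) = ngev_flow P d c 0 a.
  by rewrite mxE.
have H : prob P d c' a * node_flow P d c' (src a) @[c' --> F]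
    --> prob P d c a * node_flow P d c (src a).
  by apply: cvgM; [exact: prob_cvg|exact: node_flow_cvg].
exact (eq_ind _ (fun l => _ @ F --> l) (eq_ind _ (fun f => f @ F --> _) H _ flowE)
  _ limE).
Qed.

End Convergence.

Section Served.
Hypothesis srv : served P d.
Local Notation y := (ngev_flow P d).

(** The expected minimum costs of all origins, weighted by demand; it is the
    real value of [Hstar]. *)
Definition rHstar c := \sum_(i | i != d) emc P d c i * demand M d i.

Lemma rHstar_le c x : Xd M d x -> supported P d x ->
  rHstar c <= dot c x - rentropy P d x.
Proof.
move=> xX supp; rewrite (cost_minus_entropy dD)// lerDl.
exact: divergence_ge0.
Qed.

Lemma rHstarE c : rHstar c = dot c (y c) - rentropy P d (y c).
Proof.
rewrite (cost_minus_entropy dD) ?divergence_ngev ?addr0//.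
  exact: ngev_flow_Xd.
exact: ngev_flow_supported.
Qed.

Lemma HstarE c : Hstar P d c = (rHstar c)%:E.
Proof.
have yX : Xd M d (y c) by exact: ngev_flow_Xd.
have ysupp : supported P d (y c) by exact: ngev_flow_supported.
apply/eqP; rewrite eq_le; apply/andP; split.
  apply: ereal_inf_lbound; exists (y c) => //.
  by rewrite entropyE// ?rHstarE//; exact: yX.1.
apply: le_ereal_inf_tmp => _ [x xX <-].
have [supp|nsupp] := pselect (supported P d x).
  by rewrite entropyE//; [rewrite -EFinB lee_fin rHstar_le|exact: xX.1].
have [a xa0 na0] : exists2 a, 0 < x 0 a & ~~ (0 < allocation P d a).
  apply: contrapT => nex; apply: nsupp => a xa0.
  by apply/negPn/negP => na0; apply: nex; exists a.
by rewrite (entropyNy dD xX.1 xa0 na0) /= leey.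
Qed.

Lemma dotBl (u v x : flow) : dot (u - v) x = dot u x - dot v x.
Proof. by rewrite /dot -sumrB; apply: eq_bigr => a _; rewrite !mxE mulrBl. Qed.

(** The loading at c remains a candidate at every other cost vector, so it is a
    supergradient of the concave function [rHstar]. *)
Lemma rHstar_supergradient c c' : rHstar c' <= rHstar c + dot (c' - c) (y c).
Proof.
have := rHstar_le c' (ngev_flow_Xd dD c srv) (ngev_flow_supported (c := c)).
by move/le_trans; apply; rewrite (rHstarE c) dotBl le_eqVlt; apply/orP; left;
  apply/eqP; ring.
Qed.

(** [dot] with the linear argument last, as a derivative needs it. *)
Definition dotr x (h : flow) : R := dot h x.

Lemma dotr_is_linear x : linear (dotr x).
Proof.
move=> k u v; rewrite /dotr /dot scaler_sumr -big_split; apply: eq_bigr => a _.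
by rewrite !mxE /GRing.scale /=; ring.
Qed.
HB.instance Definition _ x := GRing.isLinear.Build R flow R _ (dotr x)
  (dotr_is_linear x).

Lemma dotr_continuous x : continuous (dotr x).
Proof.
apply: continuous_big => [|a _ h]; first exact: add_continuous.
exact (cvgMr_tmp (FF := nbhs_filter h) (@coord_continuous R 1 _ ord0 a h)).
Qed.

Lemma coord_le_norm h a : `|h 0 a| <= `|h|.
Proof. by rewrite [leRHS]/Num.norm/= mx_normrE; apply: (le_bigmax _ _ (ord0, a)). Qed.

Lemma squeeze (p q u v : R) : q <= p + u -> p <= q - v -> `|q - (p + u)| <= u - v.
Proof. by move=> qpu pqv; rewrite distrC ger0_norm ?subr_ge0//; lra. Qed.

(** Two supergradient inequalities squeeze the first-order remainder between 0
    and the inner product of h with the variation of the loading. *)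
Lemma rHstar_remainder c h :
  `|rHstar (h + c) - (rHstar c + dot h (y c))| <=
  (\sum_a `|y c 0 a - y (h + c) 0 a|) * `|h|.
Proof.
have ub : rHstar (h + c) <= rHstar c + dot h (y c).
  by have := rHstar_supergradient c (h + c); rewrite addrK.
have lb : rHstar c <= rHstar (h + c) - dot h (y (h + c)).
  have := rHstar_supergradient (h + c) c.
  rewrite opprD addrCA subrr addr0 -[- h]sub0r dotBl.
  by rewrite [dot 0 _]big1 ?sub0r// => a _; rewrite mxE mul0r.
apply: le_trans (squeeze ub lb) _.
rewrite /dot -sumrB mulr_suml; apply: ler_sum => a _.
rewrite -mulrBr; apply: le_trans (ler_norm _) _.
by rewrite normrM mulrC ler_wpM2l// coord_le_norm.
Qed.

Lemma ngev_flow_variation c (e : R) : 0 < e ->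
  \forall h \near (0 : flow), \sum_a `|y c 0 a - y (h + c) 0 a| <= e.
Proof.
move=> e0; have n0 : (0 : R) < (nlinks G).+1%:R by [].
have en0 : 0 < e / (nlinks G).+1%:R by rewrite divr_gt0.
have /filterS : \forall h \near (0 : flow), forall a,
    `|y c 0 a - y (h + c) 0 a| <= e / (nlinks G).+1%:R.
  refine (@filter_forall _ _ (fun a h => `|y c 0 a - y (h + c) 0 a| <=
    e / (nlinks G).+1%:R) (nbhs (0 : flow)) (nbhs_filter _) _) => a.
  have sh : (fun h : flow => h + c) @ (0 : flow) --> c.
    have sh0 := cvgD (FF := nbhs_filter (0 : flow)) (@cvg_id _ (nbhs (0 : flow)))
      (@cvg_cst _ c _ (nbhs (0 : flow)) (nbhs_filter _)).
    exact (eq_ind _ (fun l => _ --> l) sh0 _ (add0r c)).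
  have /cvgrPdist_le : (fun h => y (h + c) 0 a) @ (0 : flow) --> y c 0 a.
    exact (@ngev_flow_cvg _
      (fmap_filter (fun h : flow => h + c) (nbhs_filter (0 : flow))) c
      (fun b => cvg_comp _ _ sh (@coord_continuous R 1 _ ord0 b c)) a).
  exact.
apply => h small.
apply: le_trans (_ : \sum_(a < nlinks G) (e / (nlinks G).+1%:R) <= _).
  by apply: ler_sum => a _; exact: small.
rewrite sumr_const card_ord -[_ *+ nlinks G]mulr_natr -mulrA ler_piMr ?(ltW e0)//.
by rewrite mulrC ler_pdivrMr// mul1r ler_nat.
Qed.

Lemma rHstar_littleo c :
  (fine \o Hstar P d : flow -> R^o) \o shift c =
  cst (fine (Hstar P d c) : R^o) + (dotr (y c) : flow -> R^o) +o_ (0 : flow) id.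
Proof.
apply/eqaddoP => e e0; apply: filterS (ngev_flow_variation c e0) => h small.
rewrite /= !fctE /= !HstarE /=.
exact (le_trans (rHstar_remainder c h) (ler_wpM2r (normr_ge0 h) small)).
Qed.

Lemma diff_Hstar c : 'd (fine \o Hstar P d : flow -> R) c = dotr (y c) :> (flow -> R).
Proof. apply: diff_unique; [exact: dotr_continuous|exact: rHstar_littleo]. Qed.

Lemma served_differentiable c : Hstar_differentiable P d c.
Proof.
split; first by near=> c'; rewrite HstarE.
apply/diff_locallyP; rewrite diff_Hstar; split; first exact: dotr_continuous.
exact: rHstar_littleo.
Unshelve. all: by end_near. Qed.

Lemma grad_HstarE c : grad_Hstar P d c = y c.
Proof.
apply/rowP => a; rewrite mxE deriveE; last exact: (served_differentiable c).2.
rewrite diff_Hstar /dotr /dot (bigD1 a)//= big1 ?addr0 => [|b ba].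
  by rewrite mxE !eqxx mul1r.
by rewrite mxE (negbTE ba) andbF mul0r.
Qed.

End Served.
End Conjugate.

(** * The variational inequality in costs *)

Section SupplyVI.
Variables (R : realType) (G : network) (K : cost_data R G).
Local Notation flow := 'rV[R]_(nlinks G).

Lemma flowB (u v : flow) a : (u - v) 0 a = u 0 a - v 0 a.
Proof. by rewrite !mxE. Qed.

Variables (x w : flow).
Hypothesis xY : supply_feasible K x.
Hypothesis w_ge0 : forall a, 0 <= w 0 a.
Hypothesis VI : forall z, supply_feasible K z ->
  0 <= dot (x - w) (cost K z - cost K x).

(** Where x is positive, lowering a single load coordinate by the link flow
    keeps all link flows nonnegative and lowers a single cost. *)
Lemma supply_VI_le a : x 0 a <= w 0 a.
Proof.
have := xY.1 a; rewrite le_eqVlt => /predU1P[<- //|xa0].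
pose U b := load x b - (if b == a then x 0 a else 0).
have Ule b : U b <= load x b by rewrite /U gerBl; case: ifP => // _; rewrite ltW.
have zY : supply_feasible K (of_load U).
  apply/supply_feasibleP; split=> [b|rs l]; last first.
    rewrite -load_queue of_loadK; apply: le_lt_trans (Ule _) _.
    by rewrite load_queue; exact: (proj1 (supply_feasibleP K x) xY).2.
  have xb : 0 <= x 0 b - (if b == a then x 0 a else 0).
    by case: eqP => [->|_]; rewrite ?subrr// subr0; exact: xY.1.
  have [[rs [l bl]]|nb] := link_case b; last by rewrite of_load_own// /U load_own.
  rewrite bl of_load_queue {1}/U load_prev -bl.
  apply: le_trans xb _; have := Ule (prev_link rs l); lra.
have cost_other b : b != a -> cost K (of_load U) 0 b = cost K x 0 b.
  by move=> ba; apply: cost_load_eq => //; rewrite of_loadK /U (negbTE ba) subr0.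
have cost_a : cost K (of_load U) 0 a < cost K x 0 a.
  by apply: cost_load_lt => //; rewrite of_loadK /U eqxx gtrBl.
have := VI zY; rewrite /dot (bigD1 a)//= big1 ?addr0 => [|b ba]; last first.
  by rewrite !flowB cost_other// subrr mulr0.
by rewrite !flowB nmulr_lge0 ?subr_lt0// subr_le0.
Qed.

(** Raising all flows raises all costs, so no difference can be negative. *)
Lemma supply_VI_eq : x = w.
Proof.
pose one : flow := const_mx 1.
have [t [t0 zY]] : exists t, 0 < t /\ supply_feasible K (x + t *: one).
  near (0 : R)^'+ => t; have t0 : 0 < t by near: t; exact: nbhs_right_gt.
  exists t; split=> //; apply/supply_feasibleP; split=> [a|].
    by rewrite !mxE mulr1 addr_ge0 ?(ltW t0)//; exact: xY.1.
  by near: t; exact: capacity_near.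
have cost_lt a : cost K x 0 a < cost K (x + t *: one) 0 a.
  apply: cost_load_lt => //; have [[rs [l ->]]|na] := link_case a; last first.
    by rewrite !load_own// !mxE mulr1 ltrDl.
  rewrite !load_queue queue_loadD ltrDl mulr_gt0//.
  rewrite /queue_load mxE ltr_pwDl//; apply: sumr_ge0 => k _.
  by rewrite mxE.
have term_ge0 a : 0 <= (w 0 a - x 0 a) * (cost K (x + t *: one) 0 a - cost K x 0 a).
  by rewrite mulr_ge0 ?subr_ge0 ?supply_VI_le// ltW.
have sum0 : \sum_a (w 0 a - x 0 a) *
    (cost K (x + t *: one) 0 a - cost K x 0 a) = 0.
  apply/eqP; rewrite eq_le sumr_ge0// andbT -oppr_ge0 -sumrN.
  have := VI zY; rewrite /dot; congr (0 <= _); apply: eq_bigr => a _.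
  by rewrite !flowB -mulNr opprB.
apply/rowP => a; apply/esym/eqP; rewrite -subr_eq0.
have /eqP : (w 0 a - x 0 a) * (cost K (x + t *: one) 0 a - cost K x 0 a) = 0.
  by apply: (psumr_eq0P _ sum0) => // b _; exact: term_ge0.
by rewrite mulf_eq0 [X in _ || X]subr_eq0 (gt_eqF (cost_lt a)) orbF.
Unshelve. all: by end_near. Qed.

End SupplyVI.

Section CostVI.
Variables (R : realType) (G : network) (K : cost_data R G).
Variables (M : demand_data R G) (P : ngev_data M).
Local Notation flow := 'rV[R]_(nlinks G).

Lemma VI_C_ngev (c : flow) : VI_C K P c ->
  exists xh, [/\ Xhat M xh, supply_feasible K (aggregate M xh),
    c = cost K (aggregate M xh) & forall d, d \in dests M -> xh d = ngev_flow P d c].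
Proof.
move=> [[x xY <-{c}] diff VI]; exists (fun d => ngev_flow P d (cost K x)).
have srv d : d \in dests M -> served P d.
  by move=> dD; apply: (Hstar_served dD (nbhs_singleton (diff d dD).1)).
have xE : x = aggregate M (fun d => ngev_flow P d (cost K x)).
  apply: (supply_VI_eq xY) => [a|z zY].
    apply: aggregate_ge0 => d dD; exact: ngev_flow_Xd (srv d dD).
  have := VI (cost K z) (ex_intro2 _ _ z zY erefl); rewrite costK//.
  by under eq_bigr => d dD do rewrite (grad_HstarE dD (srv d dD)).
split=> //; rewrite -?xE//.
by move=> d dD; exact: ngev_flow_Xd (srv d dD).
Qed.

Lemma ngev_VI_C xh : let c := cost K (aggregate M xh) in
  Xhat M xh -> supply_feasible K (aggregate M xh) ->
  (forall d, d \in dests M -> xh d = ngev_flow P d c) ->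
  VI_C K P c.
Proof.
move=> c xhX xhY xhE.
have srv d : d \in dests M -> served P d.
  move=> dD; apply: (supported_served dD (xhX d dD)); rewrite xhE//.
  exact: ngev_flow_supported.
split; first by exists (aggregate M xh).
  by move=> d dD; exact: served_differentiable (srv d dD) _.
move=> c' _; rewrite costK//.
under eq_bigr => d dD do rewrite (grad_HstarE dD (srv d dD)) -xhE//.
by rewrite subrr /dot big1// => a _; rewrite mxE mul0r.
Qed.

End CostVI.

Theorem proposition5p2 (R : realType) (G : network) (K : cost_data R G)
    (M : demand_data R G) (P : ngev_data M) :
  (forall xh : node G -> 'rV[R]_(nlinks G),
     (exists c s, ngev_equilibrium K P c xh s) <-> VI_D K P xh) /\
  (forall c : 'rV[R]_(nlinks G),
     (exists xh s, ngev_equilibrium K P c xh s) <-> VI_C K P c).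
Proof.
split=> [xh|c]; split.
- move=> [c /ngev_equilibriumP[xhX xhY cE xhE]]; rewrite cE in xhE.
  exact (ngev_VI_D xhX xhY xhE).
- move=> VI; have [[xhX [_ xhY]] _ _] := VI.
  exists (cost K (aggregate M xh)); apply/ngev_equilibriumP; split=> // d dD.
  exact: VI_D_ngev.
- move=> [xh /ngev_equilibriumP[xhX xhY cE xhE]].
  by rewrite cE in xhE *; exact (ngev_VI_C xhX xhY xhE).
- move=> /VI_C_ngev[xh xhP]; exists xh; exact/ngev_equilibriumP.
Qed.
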